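(* Let $p\ge2$ be an integer, $h>0$, and $0<\beta<\beta_p$, where $\beta_p>0$ is defined by $8p^2\beta_p^2\exp(16\beta_p^2p)=\frac12$. Let $q\in[0,1]$ be the (unique) solution of $q=\mathbf E\big[\tanh^2\big(\beta(\frac p2)^{1/2}q^{\frac{p-1}{2}}Y+h\big)\big]$, $Y$ a standard Gaussian random variable. Then there is a constant $L$, depending neither on $l$ nor on $N$, such that for all integers $l\ge1$ and $N\ge p$ $$\nu\big((R_{1,2}-q)^{2l}\big)=\mathbf E\langle (R_{1,2}-q)^{2l}\rangle\le\Big(\frac{Ll}{N}\Big)^l .$$
   Context: $p$-spin model with external field. Let $\Sigma_N=\{-1,1\}^N$, $A_N^p=\{(i_1,\dots,i_p)\in\mathbb N^p:1\le i_1<\dots<i_p\le N\}$, $u_N=\big(\frac{p!}{2N^{p-1}}\big)^{1/2}$, and let $\{g_{i_1,\dots,i_p}:(i_1,\dots,i_p)\in A_N^p\}$ be independent standard Gaussian random variables (the disorder). The Hamiltonian is $$-H_{N,\beta,h}(\sigma)=\beta u_N\sum_{(i_1,\dots,i_p)\in A_N^p}g_{i_1,\dots,i_p}\sigma_{i_1}\cdots\sigma_{i_p}+h\sum_{i=1}^N\sigma_i,\quad \sigma\in\Sigma_N,$$ and $Z_N=\sum_{\sigma\in\Sigma_N}\exp(-H_{N,\beta,h}(\sigma))$. For $f:\Sigma_N^n\to\mathbb R$, $$\langle f\rangle=Z_N^{-n}\sum_{(\sigma^1,\dots,\sigma^n)\in\Sigma_N^n}f(\sigma^1,\dots,\sigma^n)\exp\Big(-\sum_{l\le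 n}H_{N,\beta,h}(\sigma^l)\Big),\qquad \nu(f)=\mathbf E\langle f\rangle,$$ with $\mathbf E$ the expectation over the disorder. The overlap is $R_{1,2}=\frac1N\sum_{i=1}^N\sigma_i^1\sigma_i^2$. *)

(* Defs.v *)
From HB Require Import structures.
From mathcomp Require Import all_boot all_order all_algebra.
From mathcomp Require Import all_classical all_reals all_analysis.

Set Implicit Arguments.
Unset Strict Implicit.
Unset Printing Implicit Defensive.

Import Order.TTheory GRing.Theory Num.Theory.
Import numFieldNormedType.Exports.

Local Open Scope classical_set_scope.
Local Open Scope ring_scope.

Definition tanh {R : realType} (x : R) : R :=
  (expR x - expR (- x)) / (expR x + expR (- x)).

(* Mutual independence: the product rule over every finite subfamily. *)
Definition mutually_independent {d} {T : measurableType d} {R : realType}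
    (P : probability T R) (I : finType) (X : I -> {RV P >-> R}) : Prop :=
  forall (J : {set I}) (B : I -> set R), (forall i, measurable (B i)) ->
    P (\bigcap_(i in [set` J]) (X i @^-1` B i)) =
    (\prod_(i in J) P (X i @^-1` B i))%E.

(* [normal_prob m s] is parametrised by the standard deviation [s]. *)
Definition standard_gaussian {d} {T : measurableType d} {R : realType}
    (P : probability T R) (X : {RV P >-> R}) : Prop :=
  forall B : set R, measurable B -> distribution P X B = normal_prob 0 1 B.

(* The set A_N^p of strictly increasing p-tuples of sites; the sites are
   numbered from 0 to N-1. *)
Definition increasing (N p : nat) (t : p.-tuple 'I_N) : bool :=
  sorted ltn (map (@nat_of_ord N) t).

Definition interaction (N p : nat) := {t : p.-tuple 'I_N | increasing t}.

(* Sigma_N = {-1,1}^N, a spin being coded by a boolean: false stands for +1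
   and true for -1. *)
Definition config (N : nat) := {ffun 'I_N -> bool}.

Definition spin {R : realType} {N : nat} (s : config N) (i : 'I_N) : R :=
  (-1) ^+ s i.

Definition u_scale (R : realType) (N p : nat) : R :=
  Num.sqrt ((p`!)%:R / (2 * N%:R ^+ p.-1)).

Definition hamiltonian {R : realType} {N p : nat} (beta h : R)
    (g : interaction N p -> R) (s : config N) : R :=
  - (beta * u_scale R N p *
       (\sum_(t : interaction N p) g t * \prod_(i <- val t) spin s i)
     + h * \sum_(i < N) spin s i).

Definition partition_function {R : realType} {N p : nat} (beta h : R)
    (g : interaction N p -> R) : R :=
  \sum_(s : config N) expR (- hamiltonian beta h g s).

Definition gibbs {R : realType} {N p n : nat} (beta h : R)
    (g : interaction N p -> R) (f : {ffun 'I_n -> config N} -> R) : R :=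
  (partition_function beta h g) ^- n *
  \sum_(s : {ffun 'I_n -> config N})
     f s * expR (- \sum_(l < n) hamiltonian beta h g (s l)).

Definition nu {d} {T : measurableType d} {R : realType}
    {P : probability T R} {N p n : nat} (beta h : R)
    (g : interaction N p -> {RV P >-> R})
    (f : {ffun 'I_n -> config N} -> R) : \bar R :=
  ('E_P[fun w => gibbs beta h (fun t => g t w) f])%E.

Definition overlap {R : realType} {N : nat} (s1 s2 : config N) : R :=
  N%:R^-1 * \sum_(i < N) spin s1 i * spin s2 i.

(* R_{1,2}, as a function of two replicas. *)
Definition R12 {R : realType} {N : nat} (s : {ffun 'I_2 -> config N}) : R :=
  overlap (s ord0) (s ord_max).

Definition overlap_fixpoint {R : realType} (p : nat) (beta h q : R) : Prop :=
  q%:E = ('E_(normal_prob 0%R 1%R)[fun y : R =>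
    (tanh (beta * Num.sqrt (p%:R / 2) * q `^ ((p%:R - 1) / 2) * y + h) ^+ 2)%R])%E.

(* Main.v *)
(* Latala-Guerra interpolation. Along a path indexed by an angle th in
   [0, pi/2], the disorder is multiplied by sin th while independent Gaussian
   fields, with the variance that the replica-symmetric solution predicts, are
   added at the sites with weight cos th. Write R for the overlap and follow

     u(th) = E <exp (lam(th) N (R - q)^2)>_th.

   Gaussian integration by parts expresses u' through averages over four
   replicas of exp (lam N (R_12 - q)^2) times the covariance difference
   N (R_ab^p - p q^(p-1) R_ab) / 2 + const + O(1), which a second order Taylor
   expansion bounds by N (R_ab - q)^2 p (p-1) / 4 + O(1). By the rearrangement
   inequality every pair (a, b) may be replaced with (1, 2), so the total is at
   most 8 times the term of that pair; the decrease of lam compensates it and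
   u' <= M u with M independent of N. At th = 0 the sites decouple, the products
   of the two replicas are independent signs of mean q by the fixed point
   equation, and u(0) is bounded. The high-temperature condition gives
   lam(pi/2) > 0, and an exponential moment of N (R - q)^2 bounded in N yields
   the moments. *)
Require Import Defs.
From HB Require Import structures.
From mathcomp Require Import all_boot all_order all_algebra.
From mathcomp Require Import all_classical all_reals all_analysis.
From mathcomp Require Import measurable_realfun zify ring lra.
Import Order.TTheory GRing.Theory Num.Theory.
Import numFieldNormedType.Exports.
Local Open Scope classical_set_scope.
Local Open Scope ring_scope.
Set Implicit Arguments.
Unset Strict Implicit.
Unset Printing Implicit Defensive.

(** * The standard Gaussian measure on the line *)

(** The probability space of the disorder need not carry the auxiliary site fields. The
    interpolation therefore runs on a separate finite product of Gaussian lines, and the Gibbs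
    average at the end point is carried over by equality of joint laws. Integration by parts,
    factorisation of product functionals and the comparison of laws are all proved there by adding
    one coordinate at a time.

    The four-replica averages come with weights 1, -2, -2, 3. These sum to 0, so additive constants
    in the covariance disappear; their absolute values sum to 8, which fixes the slope of [lam]. The
    site variance [beta^2 p q^(p-1) / 2] is the one that turns the covariance difference into the
    remainder of [R^p] after its tangent at [q]. The total loss of [lam] is [4 C(p,2) beta^2], at
    most 1/8 once [16 p^2 beta^2 <= 1], and the definition of the critical value yields that
    inequality. *)

Section gauss1.
Context {R : realType}.
Notation mu := (@lebesgue_measure R).
Notation gauss := (@normal_prob R 0 1).

Lemma ge0_integral_gauss (f : R -> \bar R) : measurable_fun setT f ->
  (forall x, 0 <= f x)%E ->
  (\int[gauss]_x f x = \int[mu]_x (f x * (normal_pdf 0 1 x)%:E))%E.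
Proof.
move=> mf f0.
have dom : gauss `<< mu := @normal_prob_dominates R 0 1.
rewrite -(Radon_Nikodym_SigmaFinite.change_of_variables dom)//=.
have ig := Radon_Nikodym_SigmaFinite.f_integrable dom.
apply: ae_eq_integral => //.
- by apply: emeasurable_funM => //; apply: (measurable_int mu).
- apply: emeasurable_funM => //=; apply/measurableT_comp => //=.
  exact: measurable_normal_pdf.
- apply: ae_eqe_mul2l => /=.
  (* The Radon-Nikodym derivative is determined up to a null set; it agrees with the density because
     both have the same integral over every measurable set. *)
  apply: integral_ae_eq => //=.
  + by apply/measurableT_comp =>//; exact: measurable_normal_pdf.
  + by move=> E E01 mE; rewrite -Radon_Nikodym_SigmaFinite.f_integral.
Qed.

Lemma integrable_gauss (f : R -> R) : measurable_fun setT f ->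
  gauss.-integrable setT (EFin \o f) <->
  mu.-integrable setT (fun x => (f x * normal_pdf 0 1 x)%:E).
Proof.
move=> mf.
have mfp : measurable_fun setT (fun x => (f x * normal_pdf 0 1 x)%:E).
  apply/measurableT_comp => //; apply: measurable_funM => //.
  exact: measurable_normal_pdf.
have E : (\int[gauss]_x `|(f x)%:E| = \int[mu]_x `|(f x * normal_pdf 0 1 x)%:E|)%E.
  rewrite ge0_integral_gauss//; last exact/measurableT_comp/measurableT_comp.
  apply: eq_integral => x _.
  by rewrite EFinM abseM; congr (_ * _)%E; rewrite gee0_abs// lee_fin normal_pdf_ge0.
split=> /integrableP[_ h]; apply/integrableP; split => //.
- by rewrite -E.
- exact/measurable_EFinP.
- by rewrite E.
Qed.

Lemma Rintegral_gauss (f : R -> R) : measurable_fun setT f ->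
  gauss.-integrable setT (EFin \o f) ->
  \int[gauss]_x f x = \int[mu]_x (f x * normal_pdf 0 1 x).
Proof.
move=> mf /integrableP[_ fi].
have mp : measurable_fun setT (fun x : R => (normal_pdf 0 1 x)%:E).
  by apply/measurableT_comp => //; exact: measurable_normal_pdf.
rewrite /Rintegral integralE [in RHS]integralE.
rewrite !ge0_integral_gauss//; last 2 first.
  by apply: measurable_funeneg; exact/measurable_EFinP.
  by apply: measurable_funepos; exact/measurable_EFinP.
congr (fine (_ - _)); apply: eq_integral => x _.
- rewrite !funeposE -EFin_max -EFin_max -EFinM; congr _%:E.
  by rewrite maxr_pMl ?normal_pdf_ge0// mul0r.
- rewrite !funenegE -!EFinN -!EFin_max -EFinM; congr _%:E.
  by rewrite maxr_pMl ?normal_pdf_ge0// mul0r mulNr.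
Qed.

(** Since [|x| <= 1 + x^2 / 4 <= expR (x^2 / 4)], the function [|x|] times the density is dominated
    by a multiple of the centred Gaussian density of variance 2. *)
Lemma integrable_gauss_id : gauss.-integrable setT (EFin \o (@idfun R)).
Proof.
apply/integrable_gauss; first exact: measurable_id.
have s0 : Num.sqrt 2 != 0 :> R by rewrite gt_eqF// sqrtr_gt0.
have ip := @integrable_normal_pdf R 0 (Num.sqrt 2).
pose c : R := normal_peak 1 / normal_peak (Num.sqrt 2).
apply: (le_integrable measurableT _ _ (integrableZl measurableT c ip)).
  apply/measurable_EFinP; apply: measurable_funM; first exact: measurable_id.
  exact: measurable_normal_pdf.
move=> x _ /=; rewrite lee_fin /c !normal_pdfE ?oner_eq0//.
rewrite !normrM.
rewrite !(ger0_norm (normal_fun_ge0 _ _ _)) !(ger0_norm (normal_peak_ge0 _)).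
rewrite normfV (ger0_norm (normal_peak_ge0 _)).
have p0 := normal_peak_gt0 s0.
rewrite [leRHS]mulrA divfK ?gt_eqF// mulrCA; apply: ler_wpM2l; first exact: normal_peak_ge0.
rewrite /normal_fun subr0 sqr_sqrtr// expr1n.
have -> : - x ^+ 2 / (2 *+ 2) = - x ^+ 2 / 2 + x ^+ 2 / 4 :> R by field.
rewrite expRD mulrC; apply: ler_wpM2l; first exact: expR_ge0.
apply: (le_trans _ (expR_ge1Dx _)).
rewrite -subr_ge0 -(real_normK (num_real x)).
have -> : 1 + `|x| ^+ 2 / 4 - `|x| = (`|x| / 2 - 1) ^+ 2 by field.
exact: sqr_ge0.
Qed.

Lemma is_derive_normal_pdf (x : R) :
  is_derive x 1 (normal_pdf 0 1) (- x * normal_pdf 0 1 x).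
Proof.
have -> : normal_pdf (0 : R) 1 = fun x => normal_peak 1 * expR (- x ^+ 2 / 2).
  apply/funext => y; rewrite normal_pdfE ?oner_eq0// /normal_fun.
  by rewrite subr0 expr1n.
apply: is_derive_eq; rewrite /GRing.scale/=; by field.
Qed.

(** With [phi] the density, [phi' = - x phi], so [f phi - x F phi] is the derivative of [F phi]. Its
    integral over a growing interval is a boundary term that tends to 0. *)
Lemma gauss_ibp (F f : R -> R) (C : R) :
  (forall x : R, is_derive x 1 F (f x)) -> continuous f ->
  (forall x, `|F x| <= C) -> (forall x, `|f x| <= C) ->
  \int[gauss]_x (x * F x) = \int[gauss]_x f x.
Proof.
move=> dF cf FC fC.
have C0 : 0 <= C by exact: le_trans (FC 0).
have cF : continuous F.
  by move=> x; apply: differentiable_continuous; apply/derivable1_diffP; have [] := dF x.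
have mF : measurable_fun setT F by exact: continuous_measurable_fun.
have mf : measurable_fun setT f by exact: continuous_measurable_fun.
have cphi : continuous (normal_pdf (0 : R) 1) by apply: continuous_normal_pdf; rewrite oner_eq0.
have mphi := @measurable_normal_pdf R 0 1.
have iid := (integrable_gauss (@measurable_id _ R _)).1 integrable_gauss_id.
have iphi := @integrable_normal_pdf R 0 1.
have mxF : measurable_fun setT (fun x : R => x * F x) by exact: measurable_funM.
have i1 : mu.-integrable setT (fun x => (x * F x * normal_pdf 0 1 x)%:E).
  apply: (le_integrable measurableT _ _ (integrableZl measurableT C iid)).
    by apply/measurable_EFinP; exact: measurable_funM.
  move=> x _ /=; rewrite lee_fin mulrAC mulrC !normrM (ger0_norm C0).
  by apply: ler_wpM2r; rewrite ?mulr_ge0.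
have i2 : mu.-integrable setT (fun x => (f x * normal_pdf 0 1 x)%:E).
  apply: (le_integrable measurableT _ _ (integrableZl measurableT C iphi)).
    by apply/measurable_EFinP; exact: measurable_funM.
  move=> x _ /=; rewrite lee_fin !normrM (ger0_norm C0).
  by apply: ler_wpM2r.
rewrite !Rintegral_gauss//; last 2 first.
- exact/integrable_gauss.
- exact/integrable_gauss.
apply/esym/eqP; rewrite -subr_eq0 -RintegralB//; apply/eqP.
pose hh x := f x * normal_pdf 0 1 x - x * F x * normal_pdf 0 1 x.
pose H x := F x * normal_pdf 0 1 x.
have dH (x : R) : is_derive x 1 H (hh x).
  rewrite /H /hh; have dphi := is_derive_normal_pdf x.
  apply: is_derive_eq; rewrite /GRing.scale/=; ring.
have chh : continuous hh.
  move=> x; apply: cvgB; apply: cvgM; [exact: cf|exact: cphi| |exact: cphi].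
  by apply: cvgM; [exact: cvg_id|exact: cF].
have cH : continuous H by move=> x; apply: cvgM; [exact: cF|exact: cphi].
(* The radius starts at 1, not 0: the fundamental theorem of calculus needs distinct end points. *)
have intn (n : nat) : (\int[mu]_(x in `[(- n.+1%:R)%R, n.+1%:R%R]) (hh x)%:E =
    (H n.+1%:R - H (- n.+1%:R))%:E)%E.
  rewrite EFinB; apply: continuous_FTC2.
  - by rewrite gtrN.
  - exact: continuous_subspaceT.
  - split; [by move=> x _; have [] := dH x| |].
      by apply: cvg_at_right_filter; exact: cH.
    by apply: cvg_at_left_filter; exact: cH.
  - by move=> x _; rewrite derive1E; have [_] := dH x.
have ihh : mu.-integrable setT (EFin \o hh).
  by have := integrableB measurableT i2 i1; apply: eq_integrable.
pose S n : set R := [set` `[(- n.+1%:R)%R, n.+1%:R%R]].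
have mS n : measurable (S n) by exact: measurable_itv.
have mhh : measurable_fun setT hh by exact: continuous_measurable_fun.
have mhhS n : measurable_fun setT (hh \_ (S n)).
  by apply/(measurable_restrictT _ _).1 => //; exact: measurable_funTS.
have lim1 : (\int[mu]_(x in setT) ((hh \_ (S n)) x)%:E)%E @[n --> \oo] -->
    (\int[mu]_(x in setT) (hh x)%:E)%E.
  have [] // := @dominated_convergence _ _ _ mu setT measurableT
    (fun n x => ((hh \_ (S n)) x)%:E) (EFin \o hh) (fun x => `|hh x|%:E).
  - by move=> n; apply/measurable_EFinP; exact: mhhS.
  - exact/measurable_EFinP.
  - apply/aeW => x _; apply: cvg_near_cst.
    near=> n; rewrite /= patchE mem_set// /S /= in_itv/=.
    rewrite -ler_norml (le_trans (ltW (Num.Theory.truncnS_gt _)))// ler_nat.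
    by near: n; exact: nbhs_infty_ge.
  - exact: integrable_norm ihh.
  - apply/aeW => x n _; rewrite /= lee_fin patchE; case: ifP => // _.
    by rewrite normr0.
have lim2 : (\int[mu]_(x in setT) ((hh \_ (S n)) x)%:E)%E @[n --> \oo] --> 0%E.
  have -> : (fun n => \int[mu]_(x in setT) ((hh \_ (S n)) x)%:E)%E =
      (fun n => (H n.+1%:R - H (- n.+1%:R))%:E).
    apply/funext => n; rewrite -intn [RHS]integral_mkcond restrict_EFin//.
  apply: cvg_EFin; first exact: nearW.
  (* The inequality [t <= 1 + t^2 / 2 <= expR (t^2 / 2)] reduces the Gaussian decay to the harmonic
     sequence. *)
  have Hb (y : R) n : `|y| = n.+1%:R -> `|H y| <= C * normal_peak 1 * n.+1%:R^-1.
    move=> yn; rewrite /H normrM (ger0_norm (normal_pdf_ge0 _ _ _)) -mulrA.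
    apply: ler_pM => //; first exact: normal_pdf_ge0.
    rewrite normal_pdfE ?oner_eq0// ler_wpM2l ?normal_peak_ge0//.
    rewrite /normal_fun subr0 expr1n mulNr expRN lef_pV2 ?posrE ?expR_gt0 ?ltr0n//.
    apply: (le_trans _ (expR_ge1Dx _)).
    rewrite -(real_normK (num_real y)) yn -subr_ge0.
    have -> : 1 + n.+1%:R ^+ 2 / 2 - n.+1%:R = (n.+1%:R - 1) ^+ 2 / 2 + 1 / 2 :> R by field.
    by rewrite addr_ge0// divr_ge0// sqr_ge0.
apply: norm_cvg0; apply: (squeeze_cvgr (f := cst 0) (h := fun n => 2 * (C * normal_peak 1) * harmonic n)).
  - apply: nearW => n; rewrite normr_ge0/=.
    apply: (le_trans (ler_normB _ _)); rewrite -mulrA mulr2n mulrDl !mul1r.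
    by apply: lerD; apply: Hb; rewrite ?normrN ger0_norm.
  - exact: cvg_cst.
  - rewrite -[X in _ --> X](mulr0 (2 * (C * normal_peak 1))).
    by apply: cvgM; [exact: cvg_cst|exact: cvg_harmonic].
rewrite /Rintegral.
have -> : (\int[mu]_(x in setT) (hh x)%:E = 0)%E by exact: (cvg_unique _ lim1 lim2).
by [].
Unshelve. all: by end_near.
Qed.

End gauss1.

(** * Spaces carrying independent Gaussian variables *)

Section gauss2.
Context {R : realType}.
Notation gauss := (@normal_prob R 0 1).

Definition upd (x : nat -> R) (k : nat) (y : R) : nat -> R :=
  fun j => if j == k then y else x j.

(* Measurability of a functional of many coordinates, tested along families of
   random variables: no sigma-algebra on [K -> R] is needed. *)
Definition meas_op (K : Type) (F : (K -> R) -> R) : Prop :=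
  forall d (T : measurableType d) (X : K -> T -> R),
    (forall k, measurable_fun setT (X k)) ->
    measurable_fun setT (fun w => F (fun k => X k w)).

Lemma bounded_integrable d (T : measurableType d) (Q : probability T R)
    (f : T -> R) (C : R) :
  measurable_fun setT f -> (forall w, `|f w| <= C) ->
  Q.-integrable setT (EFin \o f).
Proof.
move=> mf fC.
apply: (@le_integrable _ _ _ Q _ measurableT _ (EFin \o cst C)) => //.
- exact/measurable_EFinP.
- by move=> w _; rewrite /= lee_fin (le_trans (fC w))// ler_norm.
- exact: finite_measure_integrable_cst.
Qed.

Lemma Rfubini1 d (T : measurableType d) (Q : probability T R) (G : T * measurableTypeR R -> R) :
  (Q \x gauss)%E.-integrable setT (EFin \o G) ->
  (forall w, gauss.-integrable setT (fun y => (G (w, y))%:E)) ->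
  \int[(Q \x gauss)%E]_z G z = \int[Q]_w \int[gauss]_y G (w, y).
Proof.
move=> iG iGw; rewrite /Rintegral -integral12_prod_meas1//; congr fine.
apply: eq_integral => w _; rewrite /fubini_F /= fineK//.
exact: integrable_fin_num.
Qed.

Lemma Rfubini2 d (T : measurableType d) (Q : probability T R) (G : T * measurableTypeR R -> R) :
  (Q \x gauss)%E.-integrable setT (EFin \o G) ->
  (forall y, Q.-integrable setT (fun w => (G (w, y))%:E)) ->
  \int[(Q \x gauss)%E]_z G z = \int[gauss]_y \int[Q]_w G (w, y).
Proof.
move=> iG iGw; rewrite /Rintegral -integral21_prod_meas1//; congr fine.
apply: eq_integral => w _; rewrite /fubini_G /= fineK//.
exact: integrable_fin_num.
Qed.

Lemma integralT_cst d (T : measurableType d) (Q : probability T R) (c : \bar R) :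
  (\int[Q]_(_ in setT) c = c)%E.
Proof.
rewrite integral_cst// -[RHS]mule1; congr (_ * _)%E.
exact: (probability_setT Q).
Qed.

(** Stein's identity in coordinate [k]. The partial derivative is supplied as a second functional
    [f]; boundedness of both keeps all integrals finite. *)
Definition ibp_prop n d (T : measurableType d) (Q : probability T R)
    (X : nat -> T -> R) : Prop :=
  forall k (F f : (nat -> R) -> R) (C : R), (k < n)%N ->
    meas_op F -> meas_op f ->
    (forall x, `|F x| <= C) -> (forall x, `|f x| <= C) ->
    (forall x (y : R), is_derive y 1 (fun z => F (upd x k z)) (f (upd x k y))) ->
    (forall x, continuous (fun y => f (upd x k y))) ->
  \int[Q]_w (X k w * F (X ^~ w)) = \int[Q]_w f (X ^~ w).

(** Independence in the form used where the sites decouple. The bound 1 is stable under products, so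
    it passes through the induction and gives integrability. *)
Definition prod_prop n d (T : measurableType d) (Q : probability T R)
    (X : nat -> T -> R) : Prop :=
  forall F : nat -> R -> R, (forall k, measurable_fun setT (F k)) ->
    (forall k y, `|F k y| <= 1) ->
  \int[Q]_w (\prod_(k < n) F k (X k w)) = \prod_(k < n) \int[gauss]_y F k y.

(* The event [E] is what makes the induction on [n] work: it absorbs the last
   coordinate. *)
Definition link_prop n d (T : measurableType d) (Q : probability T R)
    (X : nat -> T -> R) : Prop :=
  forall d0 (T0 : measurableType d0) (P : probability T0 R) (g : nat -> T0 -> R),
    (forall k, measurable_fun setT (g k)) ->
  exists V : T0 -> T, [/\ measurable_fun setT V,
    (forall k w, (k < n)%N -> X k (V w) = g k w) &
    forall E, measurable E ->
      (forall B : nat -> set R, (forall k, measurable (B k)) ->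
        P (E `&` \big[setI/setT]_(k < n) (g k @^-1` B k)) =
        (P E * \prod_(k < n) gauss (B k))%E) ->
      forall C, measurable C -> P (E `&` V @^-1` C) = (P E * Q C)%E].

(* The functionals tested here read only the first [m] coordinates: this is how
   a law of [m] variables is compared with a space carrying [n >= m] of them. *)
Definition transfer_prop m d (T : measurableType d) (Q : probability T R)
    (X : nat -> T -> R) : Prop :=
  forall d0 (T0 : measurableType d0) (P : probability T0 R) (g : nat -> T0 -> R),
    (forall k, measurable_fun setT (g k)) ->
    (forall B : nat -> set R, (forall k, measurable (B k)) ->
      P (\big[setI/setT]_(k < m) (g k @^-1` B k)) = (\prod_(k < m) gauss (B k))%E) ->
  forall (F : (nat -> R) -> R) (C : R), meas_op F -> (forall x, `|F x| <= C) ->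
    (forall x x', (forall k, (k < m)%N -> x k = x' k) -> F x = F x') ->
  \int[P]_w F (g ^~ w) = \int[Q]_w F (X ^~ w).

Lemma meas_op_upd (F : (nat -> R) -> R) k (y : R) :
  meas_op F -> meas_op (fun x => F (upd x k y)).
Proof.
move=> mF d T X mX.
apply: (mF d T (fun j w => upd (X ^~ w) k y j)) => j.
by rewrite /upd; case: (j == k).
Qed.

Lemma updC (x : nat -> R) i j y z : i != j ->
  upd (upd x i y) j z = upd (upd x j z) i y.
Proof.
move=> ij; apply/funext => k; rewrite /upd; case: (eqVneq k j) => // ->.
by rewrite [j == i]eq_sym (negbTE ij).
Qed.

(** * Adjoining one Gaussian coordinate *)

Section step.
Variables (n : nat) (d : measure_display) (T : measurableType d).
Variables (Q : probability T R) (X : nat -> T -> R).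
Hypothesis mX : forall k, measurable_fun setT (X k).
Hypothesis iX : forall k, (k < n)%N -> Q.-integrable setT (EFin \o X k).

Let X' (k : nat) (z : T * measurableTypeR R) : R := upd (X ^~ z.1) n z.2 k.
Let Q' : probability (T * measurableTypeR R)%type R := (Q \x gauss)%E.

Lemma step_meas k : measurable_fun setT (X' k).
Proof.
rewrite /X' /upd; case: (k == n); first exact: measurable_snd.
exact: (measurableT_comp (mX k)).
Qed.

Lemma step_integrable k : (k < n.+1)%N -> Q'.-integrable setT (EFin \o X' k).
Proof.
move=> kn; apply/integrable12ltyP.
  by apply/measurable_EFinP; exact: step_meas.
rewrite /X' /upd /=; have [kn'|kn'] := eqVneq k n.
  rewrite integralT_cst.
  by have /integrableP[] := @integrable_gauss_id R.
rewrite (eq_integral (fun w => `|(X k w)%:E|%E)); last first.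
  by move=> w _; rewrite integralT_cst.
have kltn : (k < n)%N by move: kn; rewrite ltnS leq_eqVlt (negbTE kn').
by have /integrableP[] := iX kltn.
Qed.

Lemma step_ibp : ibp_prop n Q X -> ibp_prop n.+1 Q' X'.
Proof.
move=> ibp k F f C kn mF mf FC fC dF cf.
have C0 : 0 <= C by apply: le_trans (FC (fun=> 0)).
have mFX := mF _ _ _ step_meas; have mfX := mf _ _ _ step_meas.
have if' : Q'.-integrable setT (EFin \o (fun z => f (X' ^~ z))).
  exact: (bounded_integrable _ mfX (fun=> fC _)).
have iXF : Q'.-integrable setT (EFin \o (fun z => X' k z * F (X' ^~ z))).
  apply: (le_integrable measurableT _ _ (integrableZl measurableT C (step_integrable kn))).
    by apply/measurable_EFinP; apply: measurable_funM => //; exact: step_meas.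
  move=> z _ /=; rewrite lee_fin mulrC !normrM (ger0_norm C0).
  exact: ler_wpM2r.
have mFy y := meas_op_upd n y mF; have mfy y := meas_op_upd n y mf.
have mFw w : measurable_fun setT (fun y : R => F (upd (X ^~ w) n y)).
  apply: (mF _ _ (fun k y => upd (X ^~ w) n y k)) => j; rewrite /upd.
  by case: (j == n).
have mfw w : measurable_fun setT (fun y : R => f (upd (X ^~ w) n y)).
  apply: (mf _ _ (fun k y => upd (X ^~ w) n y k)) => j; rewrite /upd.
  by case: (j == n).
(* For the new coordinate, Fubini integrates it first and the one-dimensional identity applies. For
   an old one, the new coordinate is frozen and the identity of the previous level is used. *)
have [kn'|kn'] := eqVneq k n.
  rewrite kn' in dF cf iXF *.
  rewrite (Rfubini1 iXF); last first.
    move=> w; rewrite /X'/=.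
    apply: (le_integrable measurableT _ _ (integrableZl measurableT C integrable_gauss_id)).
      apply/measurable_EFinP; apply: measurable_funM; first by rewrite /upd eqxx.
      exact: mFw.
    move=> y _ /=; rewrite lee_fin mulrC !normrM (ger0_norm C0) /upd eqxx.
    exact: ler_wpM2r.
  rewrite (Rfubini1 if'); last first.
    by move=> w; apply: (@bounded_integrable _ _ _ _ C) => //; exact: mfw.
  apply: eq_Rintegral => w _.
  have E := @gauss_ibp _ (fun y : R => F (upd (X ^~ w) n y))
    (fun y : R => f (upd (X ^~ w) n y)) C (dF (X ^~ w)) (cf (X ^~ w))
    (fun=> FC _) (fun=> fC _).
  by refine (etrans _ E); apply: eq_Rintegral => y _; rewrite /X' /= {1}/upd eqxx.
have kltn : (k < n)%N by move: kn; rewrite ltnS leq_eqVlt (negbTE kn').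
rewrite (Rfubini2 iXF); last first.
  move=> y; rewrite /X'/=.
  apply: (le_integrable measurableT _ _ (integrableZl measurableT C (iX kltn))).
    apply/measurable_EFinP; apply: measurable_funM.
      by rewrite /upd (negbTE kn').
    exact: mFy.
  move=> w _ /=; rewrite lee_fin mulrC !normrM (ger0_norm C0) /upd (negbTE kn').
  exact: ler_wpM2r.
rewrite (Rfubini2 if'); last first.
  by move=> y; apply: (@bounded_integrable _ _ _ _ C) => //; exact: mfy.
apply: eq_Rintegral => y _.
have ext (H : (nat -> R) -> R) x :
    (fun u => H (upd (upd x k u) n y)) = (fun u => H (upd (upd x n y) k u)).
  by apply/funext => u; rewrite updC.
have E : \int[Q]_w (X k w * F (upd (X ^~ w) n y)) = \int[Q]_w f (upd (X ^~ w) n y).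
  refine (ibp k (fun x => F (upd x n y)) (fun x => f (upd x n y)) C kltn
    (mFy y) (mfy y) (fun=> FC _) (fun=> fC _) _ _) => x.
  - by move=> z; rewrite updC// ext; exact: dF.
  - by rewrite ext; exact: cf.
by refine (etrans _ E); apply: eq_Rintegral => w _; rewrite /X' /= {1}/upd (negbTE kn').
Qed.

Lemma step_prod : prod_prop n Q X -> prod_prop n.+1 Q' X'.
Proof.
move=> pp F mF F1; rewrite big_ord_recr/=.
have E z : \prod_(k < n.+1) F k (X' k z) =
    (\prod_(k < n) F k (X k z.1)) * F n z.2.
  rewrite big_ord_recr/= {2}/X' /upd eqxx; congr (_ * _).
  by apply: eq_bigr => i _; rewrite /X' /upd (ltn_eqF (ltn_ord i)).
have mP : measurable_fun setT (fun w => \prod_(k < n) F k (X k w)).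
  by apply: measurable_prod => k _; exact: measurableT_comp.
have bP w : `|\prod_(k < n) F k (X k w)| <= 1.
  by rewrite normr_prod; apply: prodr_ile1 => i _; rewrite normr_ge0 F1.
under eq_Rintegral do rewrite E.
rewrite Rfubini1.
- rewrite -pp// -RintegralZr//; last exact: (bounded_integrable Q mP bP).
  apply: eq_Rintegral => w _ /=; rewrite RintegralZl//.
  exact: (@bounded_integrable _ (measurableTypeR R) gauss (F n) 1 (mF n) (F1 n)).
- apply: (@bounded_integrable _ _ _ _ 1).
    apply: measurable_funM; first exact: (measurableT_comp mP).
    exact: (measurableT_comp (mF n)).
  by move=> z; rewrite normrM mulr_ile1.
- move=> w /=; apply: (@bounded_integrable _ _ _ _ 1).
    by apply: measurable_funM; [exact: measurable_cst|exact: mF].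
  by move=> z; rewrite normrM mulr_ile1.
Qed.

(** The previous level is applied to [E] intersected with an event on [g n], which is still
    independent of the first [n] variables. This yields the law of [(V, g n)] on rectangles, and
    these determine a finite measure. *)
Lemma step_link : link_prop n Q X -> link_prop n.+1 Q' X'.
Proof.
move=> lk d0 T0 P g mg; have [V [mV XV PV]] := lk _ _ P g mg.
have mgn : @measurable_fun _ _ T0 (measurableTypeR R) setT (g n) by exact: mg.
have mV' : @measurable_fun _ _ T0 (T * measurableTypeR R)%type setT
  (fun w => (V w, g n w)) := measurable_fun_pair mV mgn.
exists (fun w => (V w, g n w)); split => //.
  move=> k w kn; rewrite /X' /upd /=; case: eqVneq => [->//|kn'].
  by apply: XV; move: kn; rewrite ltnS leq_eqVlt (negbTE kn').
move=> E mE HE C mC.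
have gn1 : gauss setT = 1%E by exact: probability_setT.
have PE (B : set R) : measurable B ->
    P (E `&` g n @^-1` B) = (P E * gauss B)%E.
  move=> mB; have := HE (fun k => if k == n then B else setT).
  rewrite big_ord_recr/= big1 ?setTI ?eqxx; last first.
    by move=> i _; rewrite (ltn_eqF (ltn_ord i)) preimage_setT.
  move=> ->; last by move=> k; case: ifP.
  rewrite big_ord_recr/= eqxx big1 ?mul1e// => i _.
  by rewrite (ltn_eqF (ltn_ord i)) gn1.
have rect (A : set T) (B : set R) : measurable A -> measurable B ->
    P (E `&` (fun w => (V w, g n w)) @^-1` (A `*` B)) =
    (P E * Q' (A `*` B))%E.
  move=> mA mB.
  have -> : E `&` (fun w => (V w, g n w)) @^-1` (A `*` B) =
      (E `&` g n @^-1` B) `&` V @^-1` A.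
    by apply/seteqP; split => w /= [] => [|[]]; tauto.
  have mgB : measurable (g n @^-1` B) by rewrite -[_ @^-1` _]setTI; exact: mgn.
  rewrite PV//; last 2 first.
  - exact: measurableI.
  - move=> D mD; rewrite PE//.
    have := HE (fun k => if k == n then B else D k).
    rewrite !big_ord_recr/= eqxx.
    have -> : \big[setI/setT]_(k < n) (g k @^-1` (if (k : nat) == n then B else D k)) =
        \big[setI/setT]_(k < n) (g k @^-1` D k).
      by apply: eq_bigr => i _; rewrite (ltn_eqF (ltn_ord i)).
    have -> : (\prod_(k < n) gauss (if (k : nat) == n then B else D k) =
        \prod_(k < n) gauss (D k))%E.
      by apply: eq_bigr => i _; rewrite (ltn_eqF (ltn_ord i)).
    rewrite -setIA [X in E `&` X]setIC => ->; last by move=> k; case: ifP.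
    by rewrite -muleA; congr (_ * _)%E; rewrite muleC.
  by rewrite PE// /Q' /= product_measure1E// -muleA; congr (_ * _)%E; rewrite muleC.
have PEfin : P E \is a fin_num by exact: fin_num_measure.
have PE0 : 0 <= fine (P E) by rewrite fine_ge0.
pose V' : {mfun T0 >-> (T * measurableTypeR R)%type} := @mfun_Sub _ _ T0 (T * measurableTypeR R)%type _ (mem_set mV').
pose m1 : {measure set (T * measurableTypeR R) -> \bar R} := pushforward (mrestr P mE) V'.
have mV'' : measurable_fun setT V' by [].
pose m2 : {measure set (T * measurableTypeR R) -> \bar R} := mscale (NngNum PE0) Q'.
(* Both measures have total mass [P E]. Leaving the restriction to [E] unnormalised avoids a
   separate case for [P E = 0]. *)
have : m1 mV'' C = m2 C.
  apply: (@measure_unique _ _ _ [set A `*` B | A in measurable & B in measurable]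
    (fun=> setT)) => //.
  - exact: measurable_prod_measurableType.
  - move=> _ _ [A1 mA1 [B1 mB1 <-]] [A2 mA2 [B2 mB2 <-]].
    rewrite -setXI; exists (A1 `&` A2); first exact: measurableI.
    by exists (B1 `&` B2) => //; exact: measurableI.
  - by move=> _; exists setT => //; exists setT => //; rewrite setXTT.
  - by rewrite bigcup_const.
  - move=> _ [A mA [B mB <-]].
    by rewrite /m1 /m2 /= /mscale /pushforward /mrestr /= fineK// setIC rect.
  - move=> _; rewrite /m1 /= /pushforward /mrestr.
    rewrite ltey_eq fin_num_measure//; apply: measurableI => //.
    by rewrite preimage_setT.
by rewrite /m1 /m2 /= /mscale /pushforward /mrestr /= fineK// setIC.
Qed.

(** With [E] the whole space, the link says that [V] has law [Q] under [P], and [F] cannot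
    distinguish [g] from [X] read along [V]. *)
Lemma link_transfer : link_prop n Q X -> transfer_prop n Q X.
Proof.
move=> lk d0 T0 P g mg HP F C mF FC Fn; have [V [mV XV PV]] := lk _ _ P g mg.
have PT : P setT = 1%E by exact: probability_setT.
have {}PV A : measurable A -> P (V @^-1` A) = Q A.
  move=> mA; rewrite -[V @^-1` A]setTI PV//; first by rewrite PT mul1e.
  by move=> B mB; rewrite setTI HP// PT mul1e.
pose V' : {RV P >-> T} := mfun_Sub (mem_set mV).
transitivity (\int[P]_w F (X ^~ (V w))).
  apply: eq_Rintegral => w _; apply: Fn => k kn; exact/esym/XV.
have mFX := mF _ _ _ mX.
have mFXV : measurable_fun setT (fun w => F (X ^~ (V w))) by exact: (measurableT_comp mFX mV).
rewrite /Rintegral; congr fine.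
rewrite -(@integral_distribution _ _ _ _ _ P V' (fun w => (F (X ^~ w))%:E)).
- by apply: eq_measure_integral => A mA _; exact: PV.
- exact/measurable_EFinP.
- exact: (bounded_integrable P mFXV (fun=> FC _)).
Qed.

Lemma step_transfer m : (m <= n)%N -> transfer_prop m Q X -> transfer_prop m Q' X'.
Proof.
move=> mn tr d0 T0 P g mg HP F C mF FC Fm.
rewrite (tr _ _ P g mg HP F C mF FC Fm).
have mFX' := mF _ _ _ step_meas.
rewrite Rfubini1.
- apply: eq_Rintegral => w _.
  have -> : (fun y : R => F (X' ^~ (w, y))) = cst (F (X ^~ w)).
    apply/funext => y; apply: Fm => k km; rewrite /X' /upd.
    by rewrite (ltn_eqF (leq_trans km mn)).
  exact: (esym (congr1 fine (integralT_cst gauss (F (X ^~ w))%:E))).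
- exact: (bounded_integrable _ mFX' (fun=> FC _)).
- move=> w; apply: (@bounded_integrable _ _ _ _ C) => //.
  apply: (mF _ _ (fun k y => upd (X ^~ w) n y k)) => j; rewrite /upd.
  by case: (j == n).
Qed.

End step.

(** Induction from a one-point space. The link at the current level compares the full list of
    variables; shorter prefixes come from earlier levels, the new coordinate being integrated
    out. *)
Lemma gaussian_space n : exists d (T : measurableType d) (Q : probability T R)
    (X : nat -> T -> R),
  [/\ forall k, measurable_fun setT (X k),
      forall k, (k < n)%N -> Q.-integrable setT (EFin \o X k),
      ibp_prop n Q X, prod_prop n Q X &
      link_prop n Q X /\ forall m, (m <= n)%N -> transfer_prop m Q X].
Proof.
elim: n => [|n [d [T [Q [X [mX iX ibp pp [lk tr]]]]]]].
  exists default_measure_display, unit, (dirac tt), (fun _ _ => 0).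
  split => //.
  - move=> F mF F1; under eq_Rintegral do rewrite big_ord0.
    by rewrite big_ord0 /Rintegral integralT_cst.
  - have lk : link_prop 0 (dirac tt) (fun _ _ => 0 : R).
      move=> d0 T0 P g mg; exists (fun=> tt); split => //.
      move=> E mE HE C mC.
      change (P (E `&` (fun=> tt) @^-1` C) = (P E * (\d_tt C : \bar R))%E).
      rewrite diracE; have [tC|tC] := boolP (tt \in C).
        rewrite mule1 (_ : _ @^-1` C = setT) ?setIT//.
        by apply/seteqP; split => // w _ /=; exact: set_mem.
      rewrite mule0 (_ : _ @^-1` C = set0) ?setI0 ?measure0//.
      by apply/seteqP; split => // w /= /mem_set; apply/negP.
    split=> // m; rewrite leqn0 => /eqP ->; apply: link_transfer lk => k.
    exact: measurable_cst.
exists _, (T * measurableTypeR R)%type, (Q \x gauss)%E, (fun k z => upd (X ^~ z.1) n z.2 k).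
have lk' := step_link lk.
split.
- exact: step_meas.
- exact: step_integrable.
- exact: step_ibp.
- exact: step_prod.
- split=> // m; rewrite leq_eqVlt ltnS => /predU1P[->|mn].
    by apply: link_transfer lk'; exact: step_meas.
  by apply: step_transfer => //; exact: tr.
Qed.

End gauss2.

(** * Sums over increasing tuples *)

Section combinatorics.
Context {R : realType}.

(** Sorting maps tuples without repetition onto increasing ones. The fibre over an increasing tuple
    is its set of [p!] permutations, on which the product is constant. *)
Lemma sum_interaction (N p : nat) (x : 'I_N -> R) :
  (p`!)%:R * (\sum_(t : interaction N p) \prod_(i <- val t) x i) =
  \sum_(t : p.-tuple 'I_N | uniq t) \prod_(i <- t) x i.
Proof.
pose le_ord := relpre (@nat_of_ord N) leq.
have le_tot : total le_ord by move=> i j; exact: leq_total.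
have le_tr : transitive le_ord by move=> i j k; exact: leq_trans.
have le_anti : antisymmetric le_ord by move=> i j /anti_leq/val_inj.
pose srt (t : p.-tuple 'I_N) : p.-tuple 'I_N := [tuple of sort le_ord t].
have incrE (t : p.-tuple 'I_N) : increasing t = uniq t && (srt t == t).
  rewrite /increasing ltn_sorted_uniq_leq (map_inj_uniq val_inj).
  case ut: (uniq t) => //=; rewrite sorted_map -/le_ord.
  apply/idP/eqP => [st|<-]; last exact: sort_sorted.
  by apply: val_inj => /=; exact: sorted_sort.
have srtP (t : p.-tuple 'I_N) : uniq t -> increasing (srt t).
  move=> ut; rewrite incrE /= sort_uniq ut/=; apply/eqP/val_inj => /=.
  by rewrite sorted_sort// sort_sorted.
rewrite (partition_big srt (@increasing N p))//=.
transitivity (\sum_(t : p.-tuple 'I_N | increasing t) (p`!)%:R * \prod_(i <- t) x i).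
  rewrite mulr_sumr.
  by rewrite -(big_sub (@increasing N p) (fun t => (p`!)%:R * \prod_(i <- val t) x i)).
apply: eq_bigr => t it.
have ut : uniq t by move: it; rewrite incrE => /andP[].
rewrite [RHS](eq_bigr (fun _ => \prod_(i <- t) x i)); last first.
  move=> s /andP[_ /eqP <-]; apply/esym/perm_big; rewrite /srt/=.
  by rewrite perm_sort.
rewrite sumr_const mulr_natl; congr (_ *+ _).
have -> : p`! = size (permutations t) by rewrite size_permutations// size_tuple.
rewrite cardE -(size_map val); apply/perm_size.
apply: uniq_perm; first exact: permutations_uniq.
  by rewrite (map_inj_uniq val_inj) enum_uniq.
move=> s; rewrite mem_permutations; apply/idP/mapP => [st|[r]].
  have ss : size s == p by rewrite (perm_size st) size_tuple.
  exists (Tuple ss) => //; rewrite mem_enum; apply/andP; split.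
    by rewrite /= (perm_uniq st).
  apply/eqP/val_inj => /=; have /perm_sortP -> // := st.
  by move: it; rewrite incrE => /andP[_ /eqP/(congr1 val)].
rewrite mem_enum => /andP[_ /eqP <-] ->.
by rewrite perm_sym /= perm_sort.
Qed.

(** This bounds the number of tuples with a repetition. The factor [N - p] of the falling factorial
    loses at most [p * N ^ p], matching [C(p+1,2) = C(p,2) + p]. *)
Lemma ffact_lower (N p : nat) : (N ^ p <= N ^_ p + 'C(p, 2) * N ^ p.-1)%N.
Proof.
elim: p => [|p IH]; first by rewrite expn0 ffactn0.
rewrite ffactnSr /= binS bin1 expnS.
case: p IH => [|p] IH; first by rewrite expn0 ffactn0 subn0; lia.
rewrite /= in IH.
have h : (N ^_ p.+1 <= N ^ p.+1)%N.
  elim: (p.+1) => [|k IHk]; first by rewrite ffactn0 expn0.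
  by rewrite ffactnSr expnSr leq_mul// leq_subr.
have : (N * N ^ p.+1 <= N * N ^_ p.+1 + 'C(p.+1, 2) * N ^ p.+1)%N.
  rewrite [in leqRHS]expnS mulnCA -mulnDr leq_mul2l IH orbT//.
rewrite mulnBr.
have : (N ^_ p.+1 * p.+1 <= p.+1 * N ^ p.+1)%N by rewrite mulnC leq_mul2l h.
lia.
Qed.

(** The power expands over all tuples, and those with a repetition make up the error. After division
    by [N ^ p.-1] it is bounded in [N]. *)
Lemma sum_interaction_approx (N p : nat) (x : 'I_N -> R) : (0 < N)%N -> (0 < p)%N ->
  (forall i, `|x i| <= 1) ->
  `|(p`!)%:R * (\sum_(t : interaction N p) \prod_(i <- val t) x i)
    - (\sum_i x i) ^+ p| <= ('C(p, 2))%:R * N%:R ^+ p.-1.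
Proof.
move=> N0 p0 x1.
have -> : (\sum_i x i) ^+ p = \sum_(t : p.-tuple 'I_N) \prod_(i <- t) x i.
  rewrite -[in LHS](card_ord p) -prodr_const bigA_distr_bigA/=.
  rewrite (reindex (fun t : p.-tuple 'I_N => [ffun i => tnth t i])).
    apply: eq_bigr => t _; rewrite big_tuple; apply: eq_bigr => i _.
    by rewrite ffunE.
  exists (fun f : {ffun 'I_p -> 'I_N} => [tuple f i | i < p]) => t _.
    by apply: eq_from_tnth => i; rewrite tnth_mktuple ffunE.
  by apply/ffunP => i; rewrite ffunE tnth_mktuple.
rewrite sum_interaction (bigID (fun t : p.-tuple 'I_N => uniq t) predT)/=.
rewrite opprD addNKr normrN.
apply: (le_trans (ler_norm_sum _ _ _)).
apply: (@le_trans _ _ (\sum_(t : p.-tuple 'I_N | ~~ uniq t) 1)).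
  apply: ler_sum => t _; rewrite normr_prod; apply: prodr_ile1 => i _.
  by rewrite normr_ge0 x1.
rewrite sumr_const -natrX -natrM ler_nat.
have := cardC (fun t : p.-tuple 'I_N => uniq t).
rewrite card_tuple card_ord.
have -> : #|(fun t : p.-tuple 'I_N => uniq t)| = N ^_ p.
  have := card_uniq_tuples p (predT : pred 'I_N); rewrite card_ord => <-.
  by apply: eq_card => t; rewrite !inE all_predT.
have := ffact_lower N p.
set n := #|_| => h1 h2; have {h2} : (n <= 'C(p, 2) * N ^ p.-1)%N by move: h1; rewrite -h2; lia.
by apply: leq_trans; apply: eq_leq; apply: eq_card => t; rewrite !inE.
Qed.

End combinatorics.

(** * Gibbs averages over replicas *)

Lemma is_derive_fsum {R : realType} (K : finType) (h : K -> R -> R) (dh : K -> R)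
    (t : R) : (forall k, is_derive t 1 (h k) (dh k)) ->
  is_derive t 1 (fun u => \sum_k h k u) (\sum_k dh k).
Proof.
move=> H; rewrite (_ : (fun u => _) = \sum_k h k); last first.
  by apply/funext => u; rewrite fct_sumE.
by elim/big_ind2 : _ => [|f1 d1 f2 d2 h1 h2|k _];
  [exact: is_derive_cst|exact: is_deriveD|exact: H].
Qed.

Section gibbs_average.
Context {R : realType} {S : finType} (s0 : S).
Implicit Types (e g : S -> R) (f : S -> S -> R).

(* [ev e] is the Gibbs mean with weights proportional to [expR (e s)]; [av e]
   and [ev4 e] below average over two and four independent replicas. *)
Definition ev e g : R := (\sum_s expR (e s) * g s) / \sum_s expR (e s).

Definition av e f : R := ev e (fun s => ev e (f s)).

Lemma sum_expR_gt0 e : 0 < \sum_s expR (e s).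
Proof.
by rewrite (bigD1 s0)//= ltr_pwDl ?expR_gt0// sumr_ge0// => s _; rewrite expR_ge0.
Qed.

Lemma eq_ev e g1 g2 : g1 =1 g2 -> ev e g1 = ev e g2.
Proof. by move=> E; congr (_ / _); apply: eq_bigr => s _; rewrite E. Qed.

Lemma evD e g1 g2 : ev e (fun s => g1 s + g2 s) = ev e g1 + ev e g2.
Proof.
rewrite /ev -mulrDl -big_split/=; congr (_ / _).
by apply: eq_bigr => s _; rewrite mulrDr.
Qed.

Lemma evZ e c g : ev e (fun s => c * g s) = c * ev e g.
Proof.
rewrite /ev mulrA mulr_sumr; congr (_ / _).
by apply: eq_bigr => s _; rewrite mulrCA.
Qed.

Lemma evN e g : ev e (fun s => - g s) = - ev e g.
Proof. by rewrite -mulN1r -evZ; apply: eq_ev => s; rewrite mulN1r. Qed.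

Lemma ev_cst e c : ev e (fun=> c) = c.
Proof. by rewrite /ev -mulr_suml mulrAC divff ?mul1r// gt_eqF// sum_expR_gt0. Qed.

Lemma ev_le e g1 g2 : (forall s, g1 s <= g2 s) -> ev e g1 <= ev e g2.
Proof.
move=> E; rewrite /ev ler_wpM2r ?invr_ge0 ?(ltW (sum_expR_gt0 _))//.
by apply: ler_sum => s _; rewrite ler_wpM2l ?expR_ge0.
Qed.

Lemma ev_ge0 e g : (forall s, 0 <= g s) -> 0 <= ev e g.
Proof. by move=> g0; rewrite -(ev_cst e 0); exact: ev_le. Qed.

Lemma ev_norm e g c : (forall s, `|g s| <= c) -> `|ev e g| <= c.
Proof.
move=> gc; rewrite ler_norml -{1}(ev_cst e (- c)) -{2}(ev_cst e c).
by apply/andP; split; apply: ev_le => s; move: (gc s); rewrite ler_norml => /andP[].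
Qed.

Lemma ev_sum e (K : finType) (g : K -> S -> R) :
  ev e (fun s => \sum_k g k s) = \sum_k ev e (g k).
Proof.
rewrite /ev -mulr_suml exchange_big/=; congr (_ / _).
by apply: eq_bigr => s _; rewrite mulr_sumr.
Qed.

Lemma evC e f : ev e (fun s => ev e (f s)) = ev e (fun s => ev e (f ^~ s)).
Proof.
rewrite /ev; congr (_ / _).
transitivity ((\sum_s \sum_t expR (e s) * expR (e t) * f s t) / \sum_s expR (e s)).
  rewrite mulr_suml; apply: eq_bigr => s _.
  by rewrite mulrA mulr_sumr; congr (_ / _); apply: eq_bigr => t _; rewrite mulrA.
rewrite exchange_big/= mulr_suml; apply: eq_bigr => s _.
rewrite mulrA mulr_sumr; congr (_ / _); apply: eq_bigr => t _.
by rewrite mulrA [expR (e t) * _]mulrC.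
Qed.

Lemma is_derive_ev (e : R -> S -> R) (de : S -> R) (g : R -> S -> R)
    (dg : S -> R) (t : R) :
  (forall s, is_derive t 1 (fun u => e u s) (de s)) ->
  (forall s, is_derive t 1 (fun u => g u s) (dg s)) ->
  is_derive t 1 (fun u => ev (e u) (g u))
    (ev (e t) dg + ev (e t) (fun s => g t s * de s) - ev (e t) de * ev (e t) (g t)).
Proof.
move=> He Hg.
have Hx s : is_derive t 1 (fun u => expR (e u s)) (expR (e t s) * de s).
  have h := He s.
  apply: is_derive_eq; rewrite /GRing.scale/=; ring.
have HZ : is_derive t 1 (fun u => \sum_s expR (e u s)) (\sum_s expR (e t s) * de s).
  exact: is_derive_fsum.
have HN : is_derive t 1 (fun u => \sum_s expR (e u s) * g u s)
   (\sum_s (expR (e t s) * dg s + expR (e t s) * (g t s * de s))).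
  apply: is_derive_fsum => s; have h := Hg s.
  apply: is_derive_eq; rewrite /GRing.scale/=; ring.
have Z0 : \sum_s expR (e t s) != 0 by rewrite gt_eqF// sum_expR_gt0.
have HV := @is_deriveV R (fun u => \sum_s expR (e u s)) t _ 1 Z0 HZ.
apply: (is_derive_eq (is_deriveM HN HV)).
rewrite /GRing.scale/= big_split/= /ev.
by field.
Qed.

Lemma eq_av e f1 f2 : f1 =2 f2 -> av e f1 = av e f2.
Proof. by move=> E; apply: eq_ev => s; apply: eq_ev => t. Qed.

Lemma avD e f1 f2 : av e (fun s t => f1 s t + f2 s t) = av e f1 + av e f2.
Proof. by rewrite /av -evD; apply: eq_ev => s; rewrite evD. Qed.

Lemma avZ e c f : av e (fun s t => c * f s t) = c * av e f.
Proof. by rewrite /av -evZ; apply: eq_ev => s; rewrite evZ. Qed.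

Lemma av_le e f1 f2 : (forall s t, f1 s t <= f2 s t) -> av e f1 <= av e f2.
Proof. by move=> E; apply: ev_le => s; apply: ev_le. Qed.

Lemma av_ge0 e f : (forall s t, 0 <= f s t) -> 0 <= av e f.
Proof. by move=> E; apply: ev_ge0 => s; apply: ev_ge0. Qed.

Lemma av_norm e f c : (forall s t, `|f s t| <= c) -> `|av e f| <= c.
Proof. by move=> E; apply: ev_norm => s; apply: ev_norm. Qed.

(** Each of the two replicas contributes a Gibbs covariance with [de], hence the factor 2 in front
    of the subtracted product. *)
Lemma is_derive_av (e : R -> S -> R) (de : S -> R) (f : R -> S -> S -> R)
    (df : S -> S -> R) (t : R) :
  (forall s, is_derive t 1 (fun u => e u s) (de s)) ->
  (forall s s', is_derive t 1 (fun u => f u s s') (df s s')) ->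
  is_derive t 1 (fun u => av (e u) (f u))
    (av (e t) df + av (e t) (fun s s' => f t s s' * (de s + de s'))
     - 2 * ev (e t) de * av (e t) (f t)).
Proof.
move=> He Hf.
have := is_derive_ev He (fun s => is_derive_ev He (Hf s)).
congr (is_derive _ _ _ _).
rewrite /av !evD evN evZ.
have -> : ev (e t) (fun s => ev (e t) (fun s' => f t s s' * (de s + de s'))) =
    ev (e t) (fun s => ev (e t) (fun s' => f t s s' * de s')) +
    ev (e t) (fun s => ev (e t) (f t s) * de s).
  rewrite -evD; apply: eq_ev => s.
  rewrite addrC [_ * de s]mulrC -evZ -evD; apply: eq_ev => s'.
  by rewrite mulrDr [_ * de s]mulrC.
ring.
Qed.

Definition ev4 e (G : S -> S -> S -> S -> R) :=
  ev e (fun s1 => ev e (fun s2 => ev e (fun s3 => ev e (G s1 s2 s3)))).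

Lemma eq_ev4 e G1 G2 : (forall a b c d, G1 a b c d = G2 a b c d) -> ev4 e G1 = ev4 e G2.
Proof. by move=> E; do 4! apply: eq_ev => ?. Qed.

Lemma ev4D e G1 G2 : ev4 e (fun a b c d => G1 a b c d + G2 a b c d) = ev4 e G1 + ev4 e G2.
Proof.
rewrite /ev4 -evD; apply: eq_ev => a; rewrite -evD; apply: eq_ev => b.
by rewrite -evD; apply: eq_ev => c; rewrite evD.
Qed.

Lemma ev4Z e k G : ev4 e (fun a b c d => k * G a b c d) = k * ev4 e G.
Proof.
rewrite /ev4 -evZ; apply: eq_ev => a; rewrite -evZ; apply: eq_ev => b.
by rewrite -evZ; apply: eq_ev => c; rewrite evZ.
Qed.

Lemma ev4_sum e (K : finType) (G : K -> S -> S -> S -> S -> R) :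
  ev4 e (fun a b c d => \sum_k G k a b c d) = \sum_k ev4 e (G k).
Proof.
rewrite /ev4 -ev_sum; apply: eq_ev => a; rewrite -ev_sum; apply: eq_ev => b.
by rewrite -ev_sum; apply: eq_ev => c; rewrite ev_sum.
Qed.

Lemma ev4_le e G1 G2 : (forall a b c d, G1 a b c d <= G2 a b c d) -> ev4 e G1 <= ev4 e G2.
Proof. by move=> E; do 4! apply: ev_le => ?. Qed.

Lemma ev4_av e f : ev4 e (fun a b _ _ => f a b) = av e f.
Proof. by apply: eq_ev => a; apply: eq_ev => b; rewrite !ev_cst. Qed.

Lemma ev4_swap23 e G : ev4 e G = ev4 e (fun a b c d => G a c b d).
Proof. by apply: eq_ev => a; rewrite evC. Qed.

Lemma ev4_swap12 e G : ev4 e G = ev4 e (fun a b c d => G b a c d).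
Proof. by rewrite /ev4 evC. Qed.

Lemma ev4_swap34 e G : ev4 e G = ev4 e (fun a b c d => G a b d c).
Proof. by apply: eq_ev => a; apply: eq_ev => b; rewrite evC. Qed.

(* The three comparisons rest on the rearrangement inequality
   [(phi u - phi v) * (u - v) >= 0] and on exchangeability of the replicas. *)
Section comparison.
Variables (e : S -> R) (y : S -> S -> R) (phi : R -> R).
Hypothesis y_sym : forall s t, y s t = y t s.
Hypothesis phi_mono : {homo phi : u v / u <= v}.
Let f s t := phi (y s t).

Let rearr u v : phi u * v + phi v * u <= phi u * u + phi v * v.
Proof.
rewrite -subr_ge0.
have -> : phi u * u + phi v * v - (phi u * v + phi v * u) = (phi u - phi v) * (u - v) by ring.
case: (leP u v) => uv.
  by rewrite mulr_le0// subr_le0// phi_mono.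
by rewrite mulr_ge0// subr_ge0 ?phi_mono// ltW.
Qed.

Lemma comparison13 : ev4 e (fun a b c _ => f a b * y a c) <= av e (fun a b => f a b * y a b).
Proof.
have E1 := ev4_swap23 e (fun a b c _ => f a b * y a c).
have E2 := ev4_av e (fun a b => f a b * y a b).
have E3 := ev4_swap23 e (fun a b _ _ => f a b * y a b).
have := ev4_le e (fun a b c _ => rearr (y a b) (y a c)); rewrite !ev4D; lra.
Qed.

Lemma comparison23 : ev4 e (fun a b c _ => f a b * y b c) <= av e (fun a b => f a b * y a b).
Proof.
rewrite ev4_swap12; apply: le_trans comparison13.
by apply: ev4_le => a b c _; rewrite /f y_sym.
Qed.

Lemma comparison34 : ev4 e (fun a b c d => f a b * y c d) <= av e (fun a b => f a b * y a b).
Proof.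
have sw G : ev4 e G = ev4 e (fun a b c d => G c d a b).
  by rewrite ev4_swap23 ev4_swap12 ev4_swap34 ev4_swap23.
have E1 := sw (fun a b c d => f a b * y c d).
have E2 := ev4_av e (fun a b => f a b * y a b).
have E3 := sw (fun a b _ _ => f a b * y a b).
have := ev4_le e (fun a b c d => rearr (y a b) (y c d)); rewrite !ev4D; lra.
Qed.

(** The weights 1, -2, -2, 3 add up to 0, so [W] may be shifted by any constant [k] at no cost.
    Their absolute values add up to 8, and each pair of replicas is then compared with the first
    one. *)
Lemma replica_bound (W : S -> S -> R) (k K C : R) : 0 <= K -> (forall u, 0 <= phi u) ->
  (forall s t, `|W s t + k| <= K * y s t + C) ->
  ev4 e (fun a b c d => f a b * (W a b - 2 * (W a c + W b c) + 3 * W c d)) <=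
  8 * K * av e (fun a b => f a b * y a b) + 8 * C * av e f.
Proof.
move=> K0 phi0 HW.
apply: (@le_trans _ _ (ev4 e (fun a b c d => K * (f a b * y a b) +
   (2 * K * (f a b * y a c) + (2 * K * (f a b * y b c) +
   (3 * K * (f a b * y c d) + 8 * C * f a b)))))).
  apply: ev4_le => a b c d.
  have := HW a b; have := HW a c; have := HW b c; have := HW c d.
  rewrite !ler_norml => /andP[h1 h2] /andP[h3 h4] /andP[h5 h6] /andP[h7 h8].
  have := phi0 (y a b); rewrite -/(f a b) => f0.
  apply: (@le_trans _ _ (f a b * (K * y a b + 2 * K * y a c + 2 * K * y b c + 3 * K * y c d + 8 * C))).
    by apply: ler_wpM2l => //; lra.
  by rewrite le_eqVlt; apply/orP; left; apply/eqP; ring.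
rewrite !ev4D !ev4Z (ev4_av e (fun a b => f a b * y a b)) (ev4_av e f).
have h1 := ler_wpM2l K0 comparison13.
have h2 := ler_wpM2l K0 comparison23.
have h3 := ler_wpM2l K0 comparison34.
lra.
Qed.

End comparison.

(** Each factor [ev e (z k)] is realised by a fresh replica, so products of Gibbs means become one
    average over four replicas and the sum over [k] assembles the covariance [W]. *)
Lemma replica_expand e (K : finType) (c : K -> R) (z : K -> S -> R) f :
  \sum_k c k * (av e (fun a b => f a b * (z k a * z k b))
    - 2 * ev e (z k) * av e (fun a b => f a b * (z k a + z k b))
    + 3 * ev e (z k) ^+ 2 * av e f) =
  let W a b := \sum_k c k * (z k a * z k b) in
  ev4 e (fun a b u v => f a b * (W a b - 2 * (W a u + W b u) + 3 * W u v)).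
Proof.
set W := fun a b : S => \sum_k c k * (z k a * z k b); cbv zeta.
transitivity (ev4 e (fun a b u v => \sum_k c k * (f a b * (z k a * z k b)
    + (- 2 * (f a b * (z k a + z k b) * z k u) + 3 * (f a b * (z k u * z k v)))))); last first.
  apply: eq_ev4 => a b u v; rewrite /W.
  rewrite -big_split/= !mulr_sumr -sumrN -!big_split/= mulr_sumr.
  by apply: eq_bigr => k _; ring.
rewrite ev4_sum; apply: eq_bigr => k _; rewrite ev4Z; congr (_ * _).
rewrite !ev4D !ev4Z (ev4_av e (fun a b => f a b * (z k a * z k b))) -addrA; congr (_ + _).
have -> : ev4 e (fun a b u _ => f a b * (z k a + z k b) * z k u) =
   ev e (z k) * av e (fun a b => f a b * (z k a + z k b)).
  rewrite /av -evZ; apply: eq_ev => a; rewrite -evZ; apply: eq_ev => b.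
  by rewrite [RHS]mulrC -evZ; apply: eq_ev => u; rewrite ev_cst.
have -> : ev4 e (fun a b u v => f a b * (z k u * z k v)) = ev e (z k) ^+ 2 * av e f.
  rewrite /av -evZ; apply: eq_ev => a; rewrite -evZ; apply: eq_ev => b.
  rewrite [RHS]mulrC expr2 mulrA -evZ; apply: eq_ev => u.
  by rewrite [RHS]mulrAC -evZ; apply: eq_ev => v; ring.
ring.
Qed.

(** This derivative is what Gaussian integration by parts produces. Since [z] squares to 1, the
    self-overlap terms [2 a <f>] and [- 2 a <f>] cancel. *)
Lemma replica_derive (e : R -> S -> R) (t a : R) (z : S -> R) f :
  (forall s, z s ^+ 2 = 1) ->
  (forall s, is_derive t 1 (fun u => e u s) (a * z s)) ->
  is_derive t 1 (fun u => av (e u) (fun s s' => f s s' * (z s + z s'))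
      - 2 * ev (e u) z * av (e u) f)
    (2 * a * (av (e t) (fun s s' => f s s' * (z s * z s'))
    - 2 * ev (e t) z * av (e t) (fun s s' => f s s' * (z s + z s'))
    + 3 * ev (e t) z ^+ 2 * av (e t) f)).
Proof.
move=> z1 He.
have H1 := is_derive_av He (fun s s' => is_derive_cst (f s s' * (z s + z s')) t 1).
have H2 := is_derive_av He (fun s s' => is_derive_cst (f s s') t 1).
have H3 := is_derive_ev He (fun s => is_derive_cst (z s) t 1).
rewrite /cst in H1 H2 H3.
have z0 : av (e t) (fun _ _ => 0) = 0 by rewrite /av !ev_cst.
rewrite z0 in H1 H2; rewrite ev_cst in H3.
apply: is_derive_eq; rewrite /GRing.scale/=.
have -> : av (e t) (fun s s' => f s s' * (z s + z s') * (a * z s + a * z s')) =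
   2 * a * (av (e t) f + av (e t) (fun s s' => f s s' * (z s * z s'))).
  rewrite -avD -avZ; apply: eq_av => s s'.
  transitivity (a * f s s' * (z s ^+ 2 + z s' ^+ 2 + 2 * (z s * z s'))); first by ring.
  by rewrite !z1; ring.
have -> : av (e t) (fun s s' => f s s' * (a * z s + a * z s')) =
   a * av (e t) (fun s s' => f s s' * (z s + z s')).
  by rewrite -avZ; apply: eq_av => s s'; ring.
have -> : ev (e t) (fun s => z s * (a * z s)) = a.
  rewrite -[RHS](ev_cst (e t)); apply: eq_ev => s.
  by rewrite mulrCA -expr2 z1 mulr1.
rewrite evZ; ring.
Qed.

End gibbs_average.

(** * Exponential square of a sum of independent signs *)

Section binary_sums.
Context {R : realType}.

(** This is [sinh s <= s cosh s]: the difference vanishes at 0 and its derivative is [s sinh s], up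
    to the common factor 2. *)
Lemma expR_sym_sub_le (s : R) : 0 <= s ->
  expR s - expR (- s) <= s * (expR s + expR (- s)).
Proof.
pose k (x : R) := x * (expR x + expR (- x)) - (expR x - expR (- x)).
have dk (x : R) : is_derive x 1 k (x * (expR x - expR (- x))).
  rewrite /k; apply: is_derive_eq; rewrite /GRing.scale/=; ring.
move=> s0; rewrite -subr_ge0 -/(k s).
have k0 : k 0 = 0 by rewrite /k oppr0; ring.
rewrite -k0; apply: (@ger0_derive1_ndecry _ k 0) => //.
- move=> x; rewrite derive1E; have [_ ->] := dk x.
  rewrite ?in_itv/= ?andbT => x0; rewrite mulr_ge0 ?(ltW x0)// subr_ge0 ler_expR.
  lra.
- apply: continuous_subspaceT => x; apply: differentiable_continuous.
  by apply/derivable1_diffP; have [] := dk x.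
Qed.

(** The derivative of [cosh s] times [expR (- s^2 / 2)] has the sign of [sinh s - s cosh s]. *)
Lemma expR_sym_add_le (s : R) : expR s + expR (- s) <= 2 * expR (s ^+ 2 / 2).
Proof.
wlog s0 : s / 0 <= s => [H|].
  have [|/ltW sn] := leP 0 s; first exact: H.
  have := H (- s); rewrite oppr_ge0 sqrrN opprK addrC; exact.
pose k (x : R) := (expR x + expR (- x)) * expR (- (x ^+ 2 / 2)).
have dk (x : R) : is_derive x 1 k ((expR x - expR (- x) - x * (expR x + expR (- x))) * expR (- (x ^+ 2 / 2))).
  rewrite /k; apply: is_derive_eq; rewrite /GRing.scale/=; by field.
have : k s <= k 0.
  apply: (@ler0_derive1_nincry _ k 0) => //.
  - move=> x; rewrite derive1E; have [_ ->] := dk x.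
    rewrite ?in_itv/= ?andbT => x0; rewrite mulr_le0_ge0 ?expR_ge0// subr_le0.
    exact/expR_sym_sub_le/ltW.
  - apply: continuous_subspaceT => x; apply: differentiable_continuous.
    by apply/derivable1_diffP; have [] := dk x.
rewrite /k oppr0 expr0n/= mul0r oppr0 expR0 mulr1 (expRN (s ^+ 2 / 2)) ler_pdivrMr ?expR_gt0//.
Qed.

(** Symmetrisation: the sign minus its mean is centred, so [L (- s) >= 1] and
    [L s <= L s * L (- s)]. That product falls short of [cosh s ^ 2] by [q^2 sinh s ^ 2], and
    [cosh s ^ 2 <= expR (s ^ 2)]. *)
Lemma binary_mgf (q s : R) : -1 <= q <= 1 ->
  \sum_(b : bool) (1 + (-1) ^+ b * q) / 2 * expR (s * ((-1) ^+ b - q)) <= expR (s ^+ 2).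
Proof.
move=> /andP[q1 q2].
pose L (s : R) := (1 + q) / 2 * expR (s * (1 - q)) + (1 - q) / 2 * expR (s * (-1 - q)).
have -> : \sum_(b : bool) (1 + (-1) ^+ b * q) / 2 * expR (s * ((-1) ^+ b - q)) = L s.
  by rewrite big_bool/= expr0 expr1 mul1r mulN1r addrC.
have L1 x : 1 <= L x.
  apply: (@le_trans _ _ ((1 + q) / 2 * (1 + x * (1 - q)) + (1 - q) / 2 * (1 + x * (-1 - q)))).
    by rewrite le_eqVlt; apply/orP; left; apply/eqP; field.
  by apply: lerD; apply: ler_wpM2l; rewrite ?expR_ge1Dx//; lra.
have L0 x : 0 <= L x by apply: le_trans (L1 x).
apply: (@le_trans _ _ (L s * L (- s))); first by rewrite ler_peMr.
apply: (@le_trans _ _ (((expR s + expR (- s)) / 2) ^+ 2)); last first.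
  have -> : expR (s ^+ 2) = expR (s ^+ 2 / 2) ^+ 2.
    rewrite [RHS]expr2 -expRD; congr expR; by field.
  rewrite ler_pXn2r ?nnegrE ?divr_ge0 ?addr_ge0 ?expR_ge0//.
  by rewrite ler_pdivrMr// mulrC expR_sym_add_le.
have ee : expR s * expR (- s) = 1 by rewrite -expRD subrr expR0.
have E1 : expR (s * (1 - q)) * expR (- s * (1 - q)) = 1 by rewrite -expRD mulNr subrr expR0.
have E2 : expR (s * (-1 - q)) * expR (- s * (-1 - q)) = 1 by rewrite -expRD mulNr subrr expR0.
have E3 : expR (s * (1 - q)) * expR (- s * (-1 - q)) = expR s ^+ 2.
  by rewrite [RHS]expr2 -!expRD; congr expR; ring.
have E4 : expR (s * (-1 - q)) * expR (- s * (1 - q)) = expR (- s) ^+ 2.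
  by rewrite [RHS]expr2 -!expRD; congr expR; ring.
have -> : L s * L (- s) = ((1 + q) / 2) ^+ 2 * (expR (s * (1 - q)) * expR (- s * (1 - q)))
   + ((1 - q) / 2) ^+ 2 * (expR (s * (-1 - q)) * expR (- s * (-1 - q)))
   + (1 + q) / 2 * ((1 - q) / 2) * (expR (s * (1 - q)) * expR (- s * (-1 - q))
     + expR (s * (-1 - q)) * expR (- s * (1 - q))) by rewrite /L; ring.
rewrite E1 E2 E3 E4 -subr_ge0.
have -> : ((expR s + expR (- s)) / 2) ^+ 2 - (((1 + q) / 2) ^+ 2 * 1 + ((1 - q) / 2) ^+ 2 * 1
  + (1 + q) / 2 * ((1 - q) / 2) * (expR s ^+ 2 + expR (- s) ^+ 2)) =
  (q / 2 * (expR s - expR (- s))) ^+ 2 + (1 + q ^+ 2) / 2 * (expR s * expR (- s) - 1) by field.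
by rewrite ee subrr mulr0 addr0 sqr_ge0.
Qed.

(* The largest term [j = floor (|v| / 3)] already dominates: complete the
   square in [j |v| - 3/2 j^2]. This linearizes the square in the exponent. *)
Lemma expR_sqr_le_sum (v : R) (J : nat) : `|v| < 3 * J%:R ->
  expR (v ^+ 2 / 6) <= expR (3 / 2) * \sum_(j < J) expR (- (3 / 2 * j%:R ^+ 2))
    * (expR (j%:R * v) + expR (- j%:R * v)).
Proof.
move=> vJ; have v0 : 0 <= `|v| / 3 by rewrite divr_ge0.
have /andP[j1 j2] := truncn_itv v0.
set j := Num.truncn _ in j1 j2.
have jJ : (j < J)%N.
  rewrite -(ltr_nat R); apply: (le_lt_trans j1).
  by rewrite ltr_pdivrMr// mulrC.
rewrite (bigD1 (Ordinal jJ))//= mulrDr.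
rewrite -[leLHS]addr0 lerD//; last first.
  by rewrite mulr_ge0 ?expR_ge0// sumr_ge0// => i _; rewrite mulr_ge0 ?expR_ge0// addr_ge0 ?expR_ge0.
have ev : expR (j%:R * `|v|) <= expR (j%:R * v) + expR (- j%:R * v).
  have [h|h] := leP 0 v; first by rewrite ger0_norm// lerDl expR_ge0.
  by rewrite ltr0_norm// mulrN mulNr lerDr expR_ge0.
apply: (@le_trans _ _ (expR (3 / 2) * (expR (- (3 / 2 * j%:R ^+ 2)) * expR (j%:R * `|v|)))).
  rewrite -!expRD ler_expR -(real_normK (num_real v)) -subr_ge0.
  set a := `|v| in j1 j2 *; set b : R := j%:R in j1 j2 *.
  have -> : 3 / 2 + (- (3 / 2 * b ^+ 2) + b * a) - a ^+ 2 / 6 =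
     3 / 2 * (1 - (a / 3 - b)) * (1 + (a / 3 - b)) by field.
  move: j2; rewrite -(natr1 j) -/b => j2.
  by apply: mulr_ge0; [apply: mulr_ge0|]; lra.
by rewrite ler_wpM2l ?expR_ge0// ler_wpM2l ?expR_ge0.
Qed.

(** Linearising the square leaves moment generating functions at integers [j] and [- j], each at
    most [expR (j^2)]. Against the weight [expR (- 3/2 j^2)] this leaves [expR (- j^2 / 2)], which
    is summable uniformly in [N]. *)
Lemma binary_square_exp (q : R) : -1 <= q <= 1 -> forall N : nat, (0 < N)%N ->
  \sum_(t : {ffun 'I_N -> bool}) (\prod_i ((1 + (-1) ^+ t i * q) / 2)) *
    expR (6^-1 * N%:R * (N%:R^-1 * (\sum_i (-1) ^+ t i) - q) ^+ 2) <=
  2 * expR (3 / 2) / (1 - expR (- 2^-1)).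
Proof.
move=> hq N N0; have [q1 q2] := andP hq.
have N0' : 0 < N%:R :> R by rewrite ltr0n.
pose r : R := Num.sqrt N%:R.
have r0 : 0 < r by rewrite sqrtr_gt0.
have r2 : r ^+ 2 = N%:R by rewrite sqr_sqrtr// ltW.
pose p (t : {ffun 'I_N -> bool}) : R := \prod_i ((1 + (-1) ^+ t i * q) / 2).
pose v (t : {ffun 'I_N -> bool}) : R := r^-1 * \sum_i ((-1) ^+ t i - q).
have p0 t : 0 <= p t.
  by apply: prodr_ge0 => i _; case: (t i); rewrite ?expr0 ?expr1; lra.
have sgn1 (b : bool) : `|(-1) ^+ b| <= 1 :> R by rewrite normrX normrN1 expr1n.
have mgf (x : R) : \sum_t p t * expR (x * v t) <= expR (x ^+ 2).
  have -> : \sum_t p t * expR (x * v t) =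
     \prod_(i < N) \sum_(b : bool) (1 + (-1) ^+ b * q) / 2 * expR (x / r * ((-1) ^+ b - q)).
    rewrite bigA_distr_bigA/=; apply: eq_bigr => t _.
    rewrite big_split/=; congr (_ * _).
    rewrite -expR_sum; congr expR; rewrite /v mulrA mulr_sumr.
    by [].
  apply: (@le_trans _ _ (\prod_(i < N) expR ((x / r) ^+ 2))).
    apply: ler_prod => i _; rewrite binary_mgf// andbT.
    rewrite sumr_ge0// => b _; rewrite mulr_ge0 ?expR_ge0//.
    by case: b; rewrite ?expr0 ?expr1; lra.
  rewrite -expR_sum sumr_const card_ord ler_expR -mulr_natr expr_div_n r2.
  by rewrite divfK ?gt_eqF.
have vE (t : {ffun 'I_N -> bool}) : 6^-1 * N%:R * (N%:R^-1 * (\sum_i (-1) ^+ t i) - q) ^+ 2 = v t ^+ 2 / 6.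
  rewrite /v sumrB sumr_const card_ord -[q *+ N]mulr_natr -r2.
  by field; rewrite gt_eqF.
(* As [|v t| <= 2 N / r] with [r >= 1], the terms [j <= N] of the linearisation suffice for every
   [t]. *)
have vJ t : `|v t| < 3 * N.+1%:R.
  rewrite /v normrM normfV (gtr0_norm r0) mulrC ltr_pdivrMr//.
  apply: (@le_lt_trans _ _ (\sum_(i < N) 2)).
    apply: (le_trans (ler_norm_sum _ _ _)); apply: ler_sum => i _.
    apply: (le_trans (ler_normB _ _)); have := sgn1 (t i).
    have : `|q| <= 1 by rewrite ler_norml q1.
    lra.
  rewrite sumr_const card_ord -mulr_natl.
  have r1 : 1 <= r.
    by rewrite -sqrtr1 ler_sqrt// ?ler1n// ltr0n.
  rewrite -(natr1 N).
  nra.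
apply: (@le_trans _ _ (\sum_t p t * (expR (3 / 2) * \sum_(j < N.+1) expR (- (3 / 2 * j%:R ^+ 2))
    * (expR (j%:R * v t) + expR (- j%:R * v t))))).
  apply: ler_sum => t _; rewrite -/(p t) ler_wpM2l// vE.
  exact: expR_sqr_le_sum.
have -> : \sum_t p t * (expR (3 / 2) * \sum_(j < N.+1) expR (- (3 / 2 * j%:R ^+ 2))
    * (expR (j%:R * v t) + expR (- j%:R * v t))) =
  expR (3 / 2) * \sum_(j < N.+1) expR (- (3 / 2 * j%:R ^+ 2)) *
     (\sum_t p t * expR (j%:R * v t) + \sum_t p t * expR (- j%:R * v t)).
  under eq_bigr do rewrite mulrCA.
  rewrite -mulr_sumr; congr (_ * _).
  under eq_bigr do rewrite mulr_sumr.
  rewrite exchange_big/=; apply: eq_bigr => j _.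
  rewrite -big_split/= mulr_sumr; apply: eq_bigr => t _; ring.
rewrite [2 * _]mulrC -mulrA ler_wpM2l ?expR_ge0//.
(* Because [j <= j^2] for integers, the Gaussian sum is bounded by a geometric one. *)
apply: (@le_trans _ _ (\sum_(j < N.+1) 2 * expR (- 2^-1) ^+ j)).
  apply: ler_sum => j _.
  apply: (@le_trans _ _ (expR (- (3 / 2 * j%:R ^+ 2)) * (2 * expR (j%:R ^+ 2)))).
    rewrite ler_wpM2l ?expR_ge0// mulr2n mulrDl mul1r.
    by apply: lerD; [exact: mgf|rewrite -[in leRHS](sqrrN j%:R); exact: mgf].
  rewrite mulrCA -expRD ler_wpM2l// -expRM_natl ler_expR.
  case: (nat_of_ord j) => [|k]; first by rewrite expr0n/= !mulr0 mul0r oppr0 addr0.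
  have : 1 <= k.+1%:R :> R by rewrite ler1n.
  nra.
rewrite -mulr_sumr ler_wpM2l//.
have e1 : expR (- 2^-1) < 1 :> R by rewrite -[ltRHS]expR0 ltr_expR; lra.
rewrite -[leRHS]mul1r ler_pdivlMr ?subr_gt0//.
have := subrX1 (expR (- 2^-1) : R) N.+1.
have : 0 <= (expR (- 2^-1) : R) ^+ N.+1 by rewrite exprn_ge0 ?expR_ge0.
set S := \sum_(i < _) _; lra.
Qed.

End binary_sums.

(** * The interpolation *)

Section measurability.
Context {R : realType} {S : finType} (s0 : S).

Lemma measurable_ev d (T : measurableType d) (e g : S -> T -> R) :
  (forall s, measurable_fun setT (e s)) -> (forall s, measurable_fun setT (g s)) ->
  measurable_fun setT (fun w => ev (e ^~ w) (g ^~ w)).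
Proof.
move=> me mg.
have mexp s : measurable_fun setT (fun w => expR (e s w)).
  exact: (measurableT_comp (@measurable_expR R) (me s)).
(* Dividing by the positive partition sum is multiplying by [expR (- ln _)] of it, a composition of
   measurable maps. *)
have -> : (fun w => ev (e ^~ w) (g ^~ w)) = (fun w => (\sum_s expR (e s w) * g s w)
    * expR (- ln (\sum_s expR (e s w)))).
  by apply/funext => w; rewrite expRN lnK// posrE sum_expR_gt0.
apply: measurable_funM.
  by apply: measurable_sum => s; exact: measurable_funM.
have mZ : measurable_fun setT (fun w => \sum_s expR (e s w)) by exact: measurable_sum.
have mlZ := measurableT_comp (@measurable_ln R) mZ.
have mNlZ : measurable_fun setT (fun w => - ln (\sum_s expR (e s w))).
  exact: measurable_funN.
exact: (measurableT_comp (@measurable_expR R) mNlZ).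
Qed.

Lemma measurable_av d (T : measurableType d) (e : S -> T -> R) (f : S -> S -> R) :
  (forall s, measurable_fun setT (e s)) ->
  measurable_fun setT (fun w => av (e ^~ w) f).
Proof.
move=> me; rewrite /av.
apply: (@measurable_ev _ _ e (fun s w => ev (e ^~ w) (f s))) => // s.
exact: (@measurable_ev _ _ e (fun t _ => f s t)).
Qed.

End measurability.

Lemma Rintegral_fsum d (T : measurableType d) (R : realType) (Q : probability T R)
    (K : finType) (f : K -> T -> R) :
  (forall k, Q.-integrable setT (EFin \o f k)) ->
  Q.-integrable setT (fun w => (\sum_k f k w)%:E) /\
  \int[Q]_w (\sum_k f k w) = \sum_k \int[Q]_w f k w.
Proof.
move=> fi.
have E : (fun w => (\sum_k f k w)%:E) = (fun w => \sum_k (EFin \o f k) w)%E.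
  by apply/funext => w; rewrite sumEFin.
split.
  by rewrite E; apply: integrable_sum.
rewrite /Rintegral E integral_sum// -sum_fine//.
by move=> k _; exact: integrable_fin_num.
Qed.

(** * Differential inequality along the path, for a general finite Gaussian family *)

Section interpolation.
Context {R : realType} {S K : finType} (s0 : S).
Context {d : measure_display} {T : measurableType d} (Q : probability T R).
Variable X : nat -> T -> R.
Hypothesis mX : forall k, measurable_fun setT (X k).
Variables (n : nat) (idx : K -> nat).
Hypothesis idx_lt : forall k, (idx k < n)%N.
Hypothesis idx_inj : injective idx.
Hypothesis iX : forall k, (k < n)%N -> Q.-integrable setT (EFin \o X k).
Hypothesis ibpX : ibp_prop n Q X.

Variables (z : K -> S -> R) (c : S -> R).
Hypothesis z1 : forall k s, z k s ^+ 2 = 1.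
Variables (a da : K -> R -> R).
Hypothesis a_derive : forall k (x : R), is_derive x 1 (a k) (da k x).
Variables (y : S -> S -> R) (lam dlam : R -> R).
Hypothesis y_sym : forall s t, y s t = y t s.
Hypothesis y_ge0 : forall s t, 0 <= y s t.
Hypothesis lam_derive : forall x : R, is_derive x 1 lam (dlam x).
Hypothesis lam_ge0 : forall x, 0 <= lam x.
Variables (A Y Lam dLam : R).
Hypothesis a_bound : forall k x, `|a k x| <= A.
Hypothesis da_bound : forall k x, `|da k x| <= A.
Hypothesis y_bound : forall s t, y s t <= Y.
Hypothesis lam_bound : forall x, lam x <= Lam.
Hypothesis dlam_bound : forall x, `|dlam x| <= dLam.

Let pr (x : nat -> R) (k : K) : R := x (idx k).

Definition energy (th : R) (x : nat -> R) (s : S) : R :=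
  \sum_k a k th * x (idx k) * z k s + c s.

Let f (th : R) (s t : S) : R := expR (lam th * y s t).

Definition interpolant (th : R) : R := \int[Q]_w av (energy th (X ^~ w)) (f th).

(** The coefficient of [da k th * x (idx k)] in the derivative of the integrand with respect to
    [th]; integration by parts is applied to it. *)
Let D (th : R) (k : K) (x : nat -> R) : R :=
  av (energy th x) (fun s t => f th s t * (z k s + z k t))
  - 2 * ev (energy th x) (z k) * av (energy th x) (f th).

(** The partial derivative of [D] in coordinate [idx k]. *)
Let dD (th : R) (k : K) (x : nat -> R) : R :=
  2 * a k th * (av (energy th x) (fun s t => f th s t * (z k s * z k t))
    - 2 * ev (energy th x) (z k) * av (energy th x) (fun s t => f th s t * (z k s + z k t))
    + 3 * ev (energy th x) (z k) ^+ 2 * av (energy th x) (f th)).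

Let df (th : R) (s t : S) : R := dlam th * (y s t * f th s t).

Let dG (th : R) (x : nat -> R) : R :=
  av (energy th x) (df th) + \sum_k da k th * (pr x k * D th k x).

Let F : R := expR (Lam * Y).

Let f_ge0 th s t : 0 <= f th s t. Proof. exact: expR_ge0. Qed.

Let f_le th s t : f th s t <= F.
Proof. by rewrite ler_expR ler_pM. Qed.

Let f_norm th s t : `|f th s t| <= F.
Proof. by rewrite ger0_norm. Qed.

Let z_norm k s : `|z k s| <= 1.
Proof. by rewrite -(@ler_pXn2r _ 2%N)// ?nnegrE// real_normK ?num_real// z1 expr1n. Qed.

Let F0 : 0 <= F. Proof. exact: expR_ge0. Qed.

Let energy_meas d' (T' : measurableType d') (X' : nat -> T' -> R) th s :
  (forall k, measurable_fun setT (X' k)) ->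
  measurable_fun setT (fun w => energy th (X' ^~ w) s).
Proof.
move=> mX'; apply: measurable_funD; last exact: measurable_cst.
apply: measurable_sum => k; apply: measurable_funM; last exact: measurable_cst.
by apply: measurable_funM => //; exact: measurable_cst.
Qed.

Let av_meas_op th g : meas_op (fun x => av (energy th x) g).
Proof.
move=> d' T' X' mX'; apply: (measurable_av s0 (e := fun s w => energy th (X' ^~ w) s)) => s.
exact: energy_meas.
Qed.

Let ev_meas_op th g : meas_op (fun x => ev (energy th x) g).
Proof.
move=> d' T' X' mX'; apply: (measurable_ev s0 (e := fun s w => energy th (X' ^~ w) s)
  (g := fun s _ => g s)) => s; first exact: energy_meas.
exact: measurable_cst.
Qed.

Let D_meas_op th k : meas_op (D th k).
Proof.
move=> d' T' X' mX'; apply: measurable_funB; first exact: av_meas_op.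
apply: measurable_funM; last exact: av_meas_op.
by apply: measurable_funM; [exact: measurable_cst|exact: ev_meas_op].
Qed.

Let dD_meas_op th k : meas_op (dD th k).
Proof.
move=> d' T' X' mX'; apply: measurable_funM; first exact: measurable_cst.
apply: measurable_funD.
  apply: measurable_funB; first exact: av_meas_op.
  apply: measurable_funM; last exact: av_meas_op.
  by apply: measurable_funM; [exact: measurable_cst|exact: ev_meas_op].
apply: measurable_funM; last exact: av_meas_op.
apply: measurable_funM; first exact: measurable_cst.
by apply: measurable_funX; exact: ev_meas_op.
Qed.

Let ev_z th k x : `|ev (energy th x) (z k)| <= 1.
Proof. exact: ev_norm. Qed.

Let av_f th x : `|av (energy th x) (f th)| <= F.
Proof. exact: av_norm. Qed.

Let av_fzz th k x : `|av (energy th x) (fun s t => f th s t * (z k s * z k t))| <= F.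
Proof.
apply: av_norm => // s t; rewrite !normrM -[leRHS]mulr1.
by rewrite ler_pM// mulr_ile1.
Qed.

Let av_fz th k x : `|av (energy th x) (fun s t => f th s t * (z k s + z k t))| <= F * 2.
Proof.
apply: av_norm => // s t; rewrite normrM ler_pM//.
by rewrite (le_trans (ler_normD _ _))// mulr2n lerD.
Qed.

Let norm_mul_le (u v b1 b2 : R) : `|u| <= b1 -> `|v| <= b2 -> `|u * v| <= b1 * b2.
Proof. by move=> h1 h2; rewrite normrM ler_pM. Qed.

Let norm_nat m : `|m%:R| <= m%:R :> R. Proof. by rewrite normr_nat. Qed.

Let D_bound th k x : `|D th k x| <= 4 * F.
Proof.
rewrite (le_trans (ler_normB _ _))//.
have -> : 4 * F = F * 2 + 2 * 1 * F by ring.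
apply: lerD; [exact: av_fz|by apply: norm_mul_le => //; apply: norm_mul_le].
Qed.

Let dD_bound th k x : `|dD th k x| <= 2 * A * (8 * F).
Proof.
apply: norm_mul_le; first exact: norm_mul_le.
rewrite (le_trans (ler_normD _ _))//.
have -> : 8 * F = F + 2 * 1 * (F * 2) + 3 * (1 * 1) * F by ring.
apply: lerD.
  rewrite (le_trans (ler_normB _ _))//; apply: lerD; first exact: av_fzz.
  by apply: norm_mul_le; [exact: norm_mul_le|exact: av_fz].
by apply: norm_mul_le => //; apply: norm_mul_le => //; exact: norm_mul_le.
Qed.

Let energy_derive_coord th k x (u : R) s :
  is_derive u 1 (fun v => energy th (upd x (idx k) v) s) (a k th * z k s).
Proof.
rewrite /energy.
have H : is_derive u 1 (fun v => \sum_j a j th * upd x (idx k) v (idx j) * z j s)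
   (\sum_j (if j == k then a k th * z k s else 0)).
  apply: is_derive_fsum => j; rewrite /upd.
  rewrite (inj_eq idx_inj).
  case: eqVneq => [->|_]; last exact: is_derive_cst.
  by apply: is_derive_eq; rewrite /GRing.scale/=; ring.
rewrite -big_mkcond/= big_pred1_eq in H.
by apply: is_derive_eq; rewrite addr0.
Qed.

Let D_derive th k x (u : R) :
  is_derive u 1 (fun v => D th k (upd x (idx k) v)) (dD th k (upd x (idx k) u)).
Proof.
by apply: (@replica_derive _ _ s0 (fun v => energy th (upd x (idx k) v)) u (a k th) (z k) (f th)) => //.
Qed.

Let derive_continuous (g dg : R -> R) : (forall u : R, is_derive u 1 g (dg u)) -> continuous g.
Proof.
move=> H u; apply: differentiable_continuous; apply/derivable1_diffP.
by have [] := H u.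
Qed.

Let av_continuous th (k : K) x g : continuous (fun u => av (energy th (upd x (idx k) u)) g).
Proof.
apply: derive_continuous => u.
exact: (is_derive_av s0 (fun s => energy_derive_coord th k x u s)
  (fun s t => is_derive_cst (g s t) u 1)).
Qed.

Let ev_continuous th (k : K) x g : continuous (fun u => ev (energy th (upd x (idx k) u)) g).
Proof.
apply: derive_continuous => u.
exact: (is_derive_ev s0 (fun s => energy_derive_coord th k x u s)
  (fun s => is_derive_cst (g s) u 1)).
Qed.

Let dD_continuous th k x : continuous (fun u => dD th k (upd x (idx k) u)).
Proof.
move=> u; apply: cvgM; first exact: cvg_cst.
apply: cvgD.
  apply: cvgB; first exact: av_continuous.
  apply: cvgM; last exact: av_continuous.
  by apply: cvgM; [exact: cvg_cst|exact: ev_continuous].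
apply: cvgM; last exact: av_continuous.
apply: cvgM; first exact: cvg_cst.
by rewrite expr2; apply: cvgM; exact: ev_continuous.
Qed.

Let D_ibp th k : \int[Q]_w (pr (X ^~ w) k * D th k (X ^~ w)) = \int[Q]_w dD th k (X ^~ w).
Proof.
have A_ge0 : 0 <= A by exact: le_trans (a_bound k 0).
pose C := 4 * F + 2 * A * (8 * F).
apply: (@ibpX _ (D th k) (dD th k) C) => //.
- by move=> x; rewrite (le_trans (D_bound _ _ _))// lerDl !mulr_ge0.
- by move=> x; rewrite (le_trans (dD_bound _ _ _))// lerDr !mulr_ge0.
Qed.

Let av_derive (th : R) x :
  is_derive th 1 (fun u => av (energy u x) (f u)) (dG th x).
Proof.
have He s : is_derive th 1 (fun u => energy u x s) (\sum_k da k th * pr x k * z k s).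
  rewrite /energy.
  have H : is_derive th 1 (fun u => \sum_k a k u * x (idx k) * z k s)
      (\sum_k da k th * pr x k * z k s).
    apply: is_derive_fsum => k; have h := a_derive k th.
    by apply: is_derive_eq; rewrite /GRing.scale/= /pr; ring.
  by apply: is_derive_eq; rewrite addr0.
have Hf s t : is_derive th 1 (fun u => f u s t) (df th s t).
  have h := lam_derive th; rewrite /df /f.
  by apply: is_derive_eq; rewrite /GRing.scale/=; ring.
apply: (is_derive_eq (is_derive_av s0 He Hf)).
rewrite /dG -addrA; congr (_ + _).
have -> : ev (energy th x) (fun s => \sum_k da k th * pr x k * z k s) =
   \sum_k da k th * pr x k * ev (energy th x) (z k).
  by rewrite ev_sum; apply: eq_bigr => k _; rewrite evZ.
have -> : av (energy th x) (fun s s' => f th s s' *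
    (\sum_k da k th * pr x k * z k s + \sum_k da k th * pr x k * z k s')) =
  \sum_k da k th * pr x k * av (energy th x) (fun s s' => f th s s' * (z k s + z k s')).
  transitivity (av (energy th x) (fun s s' => \sum_k da k th * pr x k *
      (f th s s' * (z k s + z k s')))).
    apply: eq_av => s s'; rewrite -big_split mulr_sumr; apply: eq_bigr => k _ /=; ring.
  rewrite /av.
  under [RHS]eq_bigr do rewrite -evZ.
  rewrite -ev_sum; apply: eq_ev => s; rewrite ev_sum; apply: eq_bigr => k _.
  by rewrite evZ.
rewrite mulr_sumr mulr_suml -sumrB; apply: eq_bigr => k _; rewrite /D; ring.
Qed.

Let df_norm th s t : `|df th s t| <= dLam * (Y * F).
Proof. by do 2 apply: norm_mul_le => //; rewrite ger0_norm. Qed.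

(** A dominating function free of [th], as differentiation under the integral requires. It grows
    linearly in the Gaussian variables, hence is integrable. *)
Let G (w : T) : R := dLam * (Y * F) + \sum_(k : K) A * (4 * F) * `|X (idx k) w|.

Let G_int : Q.-integrable setT (EFin \o G).
Proof.
have h (k : K) : Q.-integrable setT (EFin \o (fun w => A * (4 * F) * `|X (idx k) w|)).
  apply: (integrableZl measurableT (A * (4 * F)) (f := EFin \o (fun w => `|X (idx k) w|))).
  exact: (integrable_norm (iX (idx_lt k))).
have [h1 _] := Rintegral_fsum h.
apply: (integrableD measurableT (f := EFin \o cst (dLam * (Y * F))) _ h1).
exact: finite_measure_integrable_cst.
Qed.

Let dG_bound th w : `|dG th (X ^~ w)| <= G w.
Proof.
rewrite (le_trans (ler_normD _ _))// lerD//.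
  by apply: av_norm.
rewrite (le_trans (ler_norm_sum _ _ _))//; apply: ler_sum => k _.
rewrite -mulrA [4 * F * _]mulrC; apply: norm_mul_le => //; exact: norm_mul_le.
Qed.

Let G_ge0 w : 0 <= G w.
Proof. exact: le_trans (dG_bound 0 w). Qed.

Let av_int th g C : (forall s t, `|g s t| <= C) ->
  Q.-integrable setT (EFin \o (fun w => av (energy th (X ^~ w)) g)).
Proof.
move=> gC; apply: (@bounded_integrable _ _ _ _ _ C).
  exact: av_meas_op.
by move=> w; exact: av_norm.
Qed.

Let interpolant_derive (th : R) :
  is_derive th 1 interpolant (\int[Q]_w dG th (X ^~ w)).
Proof.
have Ith : `]th - 1, th + 1[%classic th by rewrite /= in_itv/=; lra.
have H1 (x : R) : `]th - 1, th + 1[%classic x ->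
    Q.-integrable setT (EFin \o (fun w => av (energy x (X ^~ w)) (f x))).
  by move=> _; exact: av_int.
have H2 (x : R) w : `]th - 1, th + 1[%classic x -> setT w ->
   derivable ((fun x w => av (energy x (X ^~ w)) (f x)) ^~ w) x 1.
  by move=> _ _; have [] := av_derive x (X ^~ w).
have H3 x w : partial1of2 (fun x w => av (energy x (X ^~ w)) (f x)) x w = dG x (X ^~ w).
  by rewrite partial1of2E; have [_] := av_derive x (X ^~ w).
have H4 (x : R) w : `]th - 1, th + 1[%classic x -> setT w ->
   `|partial1of2 (fun x w => av (energy x (X ^~ w)) (f x)) x w| <= G w.
  by move=> _ _; rewrite H3.
apply: DeriveDef.
  exact: (derivable_under_integral measurableT Ith H1 H2 G_ge0 G_int H4).
rewrite -derive1E.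
have := differentiation_under_integral measurableT Ith H1 H2 G_ge0 G_int H4.
rewrite /interpolant => ->; apply: eq_Rintegral => w _.
by rewrite H3.
Qed.

Let dG_integral th : \int[Q]_w dG th (X ^~ w) =
  \int[Q]_w (av (energy th (X ^~ w)) (df th) + \sum_k da k th * dD th k (X ^~ w)).
Proof.
have i0 : Q.-integrable setT (EFin \o (fun w => av (energy th (X ^~ w)) (df th))).
  exact: av_int.
have i1 k : Q.-integrable setT (EFin \o (fun w => pr (X ^~ w) k * D th k (X ^~ w))).
  apply: (le_integrable measurableT _ _ (integrableZl measurableT (4 * F)
    (iX (idx_lt k)))).
    apply/measurable_EFinP; apply: measurable_funM; first exact: mX.
    exact: D_meas_op.
  move=> w _ /=; rewrite lee_fin mulrC !normrM ler_wpM2r//.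
  by rewrite -normrM [in leRHS]ger0_norm ?mulr_ge0.
have i2 k : Q.-integrable setT (EFin \o (fun w => dD th k (X ^~ w))).
  by apply: (@bounded_integrable _ _ _ _ _ (2 * A * (8 * F))) => //; exact: dD_meas_op.
have j1 k : Q.-integrable setT (EFin \o (fun w => da k th * (pr (X ^~ w) k * D th k (X ^~ w)))).
  exact: (integrableZl measurableT (da k th) (i1 k)).
have j2 k : Q.-integrable setT (EFin \o (fun w => da k th * dD th k (X ^~ w))).
  exact: (integrableZl measurableT (da k th) (i2 k)).
have [k1 e1] := Rintegral_fsum j1; have [k2 e2] := Rintegral_fsum j2.
rewrite /dG !RintegralD//; congr (_ + _).
rewrite e1 e2; apply: eq_bigr => k _.
transitivity (da k th * \int[Q]_w (pr (X ^~ w) k * D th k (X ^~ w))).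
  exact: (RintegralZl (da k th) measurableT (i1 k)).
by rewrite D_ibp; exact/esym/(RintegralZl (da k th) measurableT (i2 k)).
Qed.

Variables (Th M : R).
Hypothesis Th0 : 0 <= Th.
(** [k0] is the free shift of the covariance, [K0] the part that the decrease of [lam] must absorb
    after the factor 8 of [replica_bound], and [C0] the remainder that feeds the exponential growth
    rate [M]. *)
Hypothesis control : forall x : R, 0 < x < Th -> exists k0 K0 C0 : R,
  [/\ 0 <= K0, dlam x + 8 * K0 <= 0, 8 * C0 <= M &
      forall s t, `|\sum_k 2 * (a k x * da k x) * (z k s * z k t) + k0|
        <= K0 * y s t + C0].

Let integrand_le th x : 0 < th < Th ->
  av (energy th x) (df th) + \sum_k da k th * dD th k x <= M * av (energy th x) (f th).
Proof.
move=> /control[k0 [K0 [C0 [K0_ge0 HK HM HW]]]].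
have -> : \sum_k da k th * dD th k x =
  \sum_k (2 * (a k th * da k th)) * (av (energy th x) (fun s t => f th s t * (z k s * z k t))
    - 2 * ev (energy th x) (z k) * av (energy th x) (fun s t => f th s t * (z k s + z k t))
    + 3 * ev (energy th x) (z k) ^+ 2 * av (energy th x) (f th)).
  by apply: eq_bigr => k _; rewrite /dD; ring.
rewrite replica_expand//=.
have phi_mono : {homo (fun u => expR (lam th * u)) : u v / u <= v}.
  by move=> u v uv; rewrite ler_expR ler_wpM2l.
have := replica_bound s0 (energy th x) y_sym phi_mono K0_ge0
  (fun u => expR_ge0 _) HW.
have Ef : av (energy th x) (fun s t => expR (lam th * y s t) * y s t) =
   av (energy th x) (fun s t => y s t * f th s t).
  by apply: eq_av => s t; rewrite mulrC.
rewrite -/(f th) Ef {Ef} /df avZ => h.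
have yf0 : 0 <= av (energy th x) (fun s t => y s t * f th s t).
  by apply: av_ge0 => // s t; rewrite mulr_ge0.
have f0 : 0 <= av (energy th x) (f th) by exact: av_ge0.
have h1 := ler_wpM2r yf0 HK; have h2 := ler_wpM2r f0 HM.
rewrite mul0r in h1.
apply: (le_trans (lerD (lexx _) h)); lra.
Qed.

(** Gronwall's argument: the interpolant times [expR (- M th)] is nonincreasing. *)
Lemma interpolant_le : interpolant Th <= expR (M * Th) * interpolant 0.
Proof.
pose g th := interpolant th * expR (- (M * th)).
have dg (th : R) : is_derive th 1 g
    ((\int[Q]_w dG th (X ^~ w) - M * interpolant th) * expR (- (M * th))).
  rewrite /g; have h := interpolant_derive th.
  by apply: is_derive_eq; rewrite /GRing.scale/=; ring.
suff : g Th <= g 0.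
  by rewrite /g mulr0 oppr0 expR0 mulr1 expRN ler_pdivrMr ?expR_gt0// mulrC.
apply: (@ler0_derive1_nincr _ g 0 Th) => //.
- move=> th thI; rewrite derive1E; have [_ ->] := dg th.
  rewrite mulr_le0_ge0 ?expR_ge0// subr_le0 dG_integral.
  have th0 : 0 < th < Th by move: thI; rewrite in_itv.
  have if0 := @av_int th (f th) F (f_norm th).
  rewrite /interpolant -RintegralZl//; apply: le_Rintegral => //.
  + have i2 k : Q.-integrable setT (EFin \o (fun w => dD th k (X ^~ w))).
      by apply: (@bounded_integrable _ _ _ _ _ (2 * A * (8 * F))) => //; exact: dD_meas_op.
    have [k2 _] := Rintegral_fsum (fun k => integrableZl measurableT (da k th) (i2 k)).
    exact: (integrableD measurableT (@av_int th (df th) _ (df_norm th)) k2).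
  + exact: (integrableZl measurableT M if0).
  + by move=> w _; exact: integrand_le.
- by apply: continuous_subspaceT; exact: (derive_continuous dg).
Qed.

End interpolation.

(** * Scalar inequalities and explicit two-replica averages *)

Section elementary.
Context {R : realType}.

(** Raise [x / l <= expR (x / l)] to the power [l]. This is the source of [l ^ l] in the final
    estimate. *)
Lemma expr_le_expR (l : nat) (x : R) : 0 <= x -> x ^+ l <= l%:R ^+ l * expR x.
Proof.
case: l => [|l] x0; first by rewrite !expr0 mul1r -expR0 ler_expR.
have l0 : 0 < l.+1%:R :> R by [].
have -> : expR x = expR (x / l.+1%:R) ^+ l.+1.
  by rewrite -expRM_natl mulrC divfK ?gt_eqF.
rewrite -exprMn ler_pXn2r ?nnegrE ?mulr_ge0 ?expR_ge0//.
rewrite mulrC -ler_pdivrMr//.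
by apply: le_trans (expR_ge1Dx _); rewrite lerDr.
Qed.

(** The left side is the remainder of [r^p] after its tangent at [q]. It satisfies
    [T_(p+1) = r T_p + p q^(p-1) (r - q)^2], so the constants add up to the binomial coefficient,
    for [r] of either sign. *)
Lemma expr_taylor1 (p : nat) (r q : R) : (0 < p)%N -> `|r| <= 1 -> `|q| <= 1 ->
  `|r ^+ p - p%:R * q ^+ p.-1 * r + p.-1%:R * q ^+ p| <= 'C(p, 2)%:R * (r - q) ^+ 2.
Proof.
case: p => // p _ r1 q1; elim: p => [|p IH].
  by rewrite bin_small// expr1 expr0 !mul1r subrr !mul0r add0r normr0.
have -> : r ^+ p.+2 - p.+2%:R * q ^+ p.+1 * r + p.+1%:R * q ^+ p.+2 =
   r * (r ^+ p.+1 - p.+1%:R * q ^+ p * r + p%:R * q ^+ p.+1)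
   + p.+1%:R * (q ^+ p * (r - q) ^+ 2).
  by rewrite -!natr1 !exprS; ring.
rewrite binS bin1 natrD mulrDl (le_trans (ler_normD _ _))// lerD//.
  by rewrite normrM -[leRHS]mul1r ler_pM.
rewrite normrM normr_nat ler_wpM2l// normrM (ger0_norm (sqr_ge0 _)).
rewrite -[leRHS]mul1r ler_wpM2r ?sqr_ge0//.
by rewrite normrX exprn_ile1.
Qed.

Lemma tanh_sqr_le1 (x : R) : 0 <= tanh x ^+ 2 <= 1.
Proof.
rewrite sqr_ge0 /tanh expr_div_n ler_pdivrMr ?exprn_gt0 ?addr_gt0 ?expR_gt0//.
rewrite mul1r -subr_ge0.
have -> : (expR x + expR (- x)) ^+ 2 - (expR x - expR (- x)) ^+ 2 = 4 * (expR x * expR (- x)) by ring.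
by rewrite !mulr_ge0 ?expR_ge0.
Qed.

Lemma measurable_tanh : measurable_fun setT (@tanh R).
Proof.
have E : @tanh R = fun x => (expR x - expR (- x)) * expR (- ln (expR x + expR (- x))).
  by apply/funext => x; rewrite [expR (- ln _)]expRN lnK// posrE addr_gt0 ?expR_gt0.
have mN : measurable_fun setT (fun x : R => expR (- x)).
  have mo : measurable_fun setT (fun x : R => - x) by exact: measurable_funN.
  exact: (measurableT_comp (@measurable_expR R) mo).
have mE := @measurable_expR R.
have ms := measurable_funD mE mN.
rewrite E; apply: measurable_funM; first exact: measurable_funB.
have ml := measurableT_comp (@measurable_ln R) ms.
have mnl : measurable_fun setT (fun x : R => - ln (expR x + expR (- x))) by exact: measurable_funN.
exact: (measurableT_comp mE mnl).
Qed.

(** For two independent spins in the field [c], this is the probability that their product has sign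
    [b]; the product has mean [tanh c ^ 2]. *)
Lemma field_pair_weight (c : R) (b : bool) :
  (\sum_(a : bool) expR (c * (-1) ^+ a) * expR (c * (-1) ^+ (a (+) b)))
   / (\sum_(a : bool) expR (c * (-1) ^+ a)) ^+ 2 =
  (1 + (-1) ^+ b * tanh c ^+ 2) / 2.
Proof.
have s0 : expR c + expR (- c) != 0 :> R by rewrite gt_eqF// addr_gt0 ?expR_gt0.
have ee : expR c * expR (- c) = 1 by rewrite -expRD subrr expR0.
rewrite !big_bool /tanh; case: b; rewrite /= ?expr0 ?expr1 ?mulr1 ?mulrN1 ?mul1r ?mulN1r.
  transitivity (2 * (expR c * expR (- c)) / (expR c + expR (- c)) ^+ 2).
    by congr (_ / _); ring.
  by field.
by field.
Qed.

Lemma av_product_field (N : nat) (c : 'I_N -> R) (F : {ffun 'I_N -> bool} -> R) :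
  av (fun s : config N => \sum_i c i * spin s i)
     (fun s t => F [ffun i => s i (+) t i]) =
  \sum_(e : {ffun 'I_N -> bool}) F e *
    \prod_i ((1 + (-1) ^+ e i * tanh (c i) ^+ 2) / 2).
Proof.
pose E (s : config N) : R := \sum_i c i * spin s i.
pose sh (s e : config N) : config N := [ffun i => s i (+) e i].
have shK s e : sh s (sh s e) = e by apply/ffunP => i; rewrite !ffunE addKb.
have ZE : \sum_s expR (E s) = \prod_i \sum_(a : bool) expR (c i * (-1) ^+ a).
  by rewrite bigA_distr_bigA/=; apply: eq_bigr => s _; rewrite -expR_sum.
rewrite /av /ev -/E -/sh.
transitivity (\sum_(e : config N) F e * ((\sum_(s : config N) expR (E s) * expR (E (sh s e)))
    / (\sum_s expR (E s)) ^+ 2)).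
  transitivity ((\sum_s \sum_t expR (E s) * expR (E t) * F (sh s t)) / (\sum_s expR (E s)) ^+ 2).
    rewrite expr2 invfM mulrA; congr (_ / _); rewrite mulr_suml.
    apply: eq_bigr => s _; rewrite mulrA mulr_sumr; congr (_ / _).
    by apply: eq_bigr => t _; rewrite mulrA.
  under eq_bigr => s _.
    (* The second replica is replaced by its sitewise product with the first, the only quantity that
       [F] reads. *)
    rewrite (reindex_onto (sh s) (sh s))/=; last by move=> t _.
    under eq_bigl do rewrite shK eqxx.
    under eq_bigr do rewrite shK.
    over.
  rewrite exchange_big/= mulr_suml; apply: eq_bigr => e _.
  by rewrite -mulr_suml [_ * F e]mulrC mulrA.
apply: eq_bigr => e _; congr (_ * _).
rewrite ZE -prodrXl -prodfV.
have -> : \sum_(s : config N) expR (E s) * expR (E (sh s e)) =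
   \prod_i \sum_(a : bool) expR (c i * (-1) ^+ a) * expR (c i * (-1) ^+ (a (+) e i)).
  rewrite bigA_distr_bigA/=; apply: eq_bigr => s _.
  rewrite big_split/= -!expR_sum; congr (_ * expR _).
  by apply: eq_bigr => i _; rewrite /spin ffunE.
rewrite -big_split/=; apply: eq_bigr => i _; exact: field_pair_weight.
Qed.

Lemma gibbs_av (N p : nat) (beta h : R) (g : interaction N p -> R)
    (F : config N -> config N -> R) :
  gibbs beta h g (fun s : {ffun 'I_2 -> config N} => F (s ord0) (s ord_max)) =
  av (fun s => - hamiltonian beta h g s) F.
Proof.
rewrite /gibbs /av /ev /partition_function.
set H := fun s => - hamiltonian beta h g s.
transitivity ((\sum_s \sum_t expR (H s) * expR (H t) * F s t) / (\sum_s expR (H s)) ^+ 2); last first.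
  rewrite expr2 invfM mulrA; congr (_ / _); rewrite mulr_suml.
  apply: eq_bigr => s _; rewrite mulrA mulr_sumr; congr (_ / _).
  by apply: eq_bigr => t _; rewrite mulrA.
rewrite mulrC; congr (_ / _); rewrite pair_big/=.
rewrite (reindex (fun ab : config N * config N =>
  [ffun i : 'I_2 => if i == ord0 then ab.1 else ab.2]))/=; last first.
  exists (fun s : {ffun 'I_2 -> config N} => (s ord0, s ord_max)) => [[a b]|s] _.
    by rewrite !ffunE.
  apply/ffunP => i; rewrite ffunE /=; case: eqP => [->//|].
  by move=> /eqP i0; congr (s _); apply: val_inj; case: i i0 => [[|[|i]] Hi].
apply: eq_bigr => -[a b] _ /=.
by rewrite !ffunE/= mulrC !big_ord_recl big_ord0 addr0 !ffunE/= opprD expRD.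
Qed.

End elementary.

(** * The p-spin model *)

Section independent_family.
Context {R : realType} {d : measure_display} {T : measurableType d}.
Context {P : probability T R} {I : finType} (g : I -> {RV P >-> R}).
Notation gauss := (@normal_prob R 0 1).

(** Numbering the family by naturals fits it to the sequences used for Gaussian spaces. The padding
    value 0 lies beyond the prefix on which laws are compared. *)
Definition nat_family (k : nat) (w : T) : R :=
  if insub k is Some o then g (enum_val (o : 'I_#|I|)) w else 0.

Lemma nat_family_rank (t : I) w : nat_family (enum_rank t) w = g t w.
Proof. by rewrite /nat_family valK enum_rankK. Qed.

Lemma nat_family_meas k : measurable_fun setT (nat_family k).
Proof. by rewrite /nat_family; case: (insub k). Qed.

Lemma nat_family_law : (forall t, standard_gaussian (g t)) ->
  mutually_independent g ->
  forall B : nat -> set R, (forall k, measurable (B k)) ->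
  P (\big[setI/setT]_(k < #|I|) (nat_family k @^-1` B k)) =
  (\prod_(k < #|I|) gauss (B k))%E.
Proof.
move=> hg hi B mB.
pose J : {set I} := [set t : I | true]%SET.
have := hi J (fun t => B (enum_rank t)) (fun t => mB _).
have -> : \bigcap_(i in [set` J]) (g i @^-1` B (enum_rank i)) =
    \big[setI/setT]_(k < #|I|) (nat_family k @^-1` B k).
  rewrite -(bigcap_mkord _ (fun k => nat_family k @^-1` B k)).
  apply/seteqP; split => w /= H.
    move=> k /= kn; have := H (enum_val (Ordinal kn)).
    rewrite /= inE => /(_ isT); rewrite enum_valK /= /nat_family.
    by rewrite (insubT (fun k => (k < #|I|)%N) kn).
  move=> t _ /=; rewrite -nat_family_rank.
  by apply: H => /=; exact: ltn_ord.
move=> ->; rewrite (reindex (@enum_val I predT))/=; last exact/onW_bij/enum_val_bij.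
apply: eq_big => k; first by rewrite inE.
by move=> _; rewrite enum_valK; exact: hg.
Qed.

End independent_family.

Section model.
Context {R : realType} (p : nat) (h beta q : R).
Hypothesis hp : (2 <= p)%N.

Hypothesis hbeta : 16 * p%:R ^+ 2 * beta ^+ 2 <= 1.
Hypothesis hq01 : 0 <= q <= 1.
Hypothesis hq : overlap_fixpoint p beta h q.
Notation gauss := (@normal_prob R 0 1).

Let kap : R := 'C(p, 2)%:R.
(** The standard deviation of the site field, with which [B Y + h] is the argument of [tanh] in the
    fixed point equation. *)
Let B : R := beta * Num.sqrt (p%:R / 2) * q `^ ((p%:R - 1) / 2).

(* Any starting value in [(1/8, 1/4)] would do: [binary_square_exp] handles [1/6],
   and [4 kap beta^2 <= 1/8] keeps [lam] above [1/24]. *)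
Let lam (th : R) : R := 6^-1 - 4 * kap * beta ^+ 2 * sin th ^+ 2.
Let dlam (th : R) : R := - (8 * kap * beta ^+ 2 * (sin th * cos th)).

Let q1 : `|q| <= 1.
Proof. by rewrite ger0_norm; case/andP: hq01. Qed.

Let sin_sqr_le1 (x : R) : sin x ^+ 2 <= 1.
Proof. by rewrite -(cos2Dsin2 x) lerDr sqr_ge0. Qed.

Let kap_ge0 : 0 <= kap. Proof. exact: ler0n. Qed.

(** From [2 kap = p (p - 1) <= p^2], the left side is at most [2 p^2 beta^2]. *)
Let kap_beta : 4 * kap * beta ^+ 2 <= 8^-1.
Proof.
have b2 : 0 <= beta ^+ 2 by exact: sqr_ge0.
have : 2 * kap <= p%:R ^+ 2.
  have -> : 2 * kap = ('C(p, 2) * 2)%:R by rewrite natrM mulrC.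
  rewrite -natrX ler_nat bin2 muln2.
  have /leq_trans -> // : ((p * p.-1)./2.*2 <= p * p.-1)%N.
    by rewrite -[leqRHS]odd_double_half leq_addl.
  by rewrite -mulnn leq_mul2l leq_pred orbT.
move=> kp; have := ler_wpM2r b2 kp; have := hbeta; lra.
Qed.

Let lam_ge (th : R) : 24^-1 <= lam th.
Proof.
have c0 : 0 <= 4 * kap * beta ^+ 2 by rewrite !(sqr_ge0, mulr_ge0).
have := ler_wpM2l c0 (sin_sqr_le1 th); rewrite mulr1 /lam.
have := kap_beta; lra.
Qed.

Let lam_le (th : R) : lam th <= 6^-1.
Proof. by rewrite /lam lerBlDr lerDl !(sqr_ge0, mulr_ge0). Qed.

Let lam_derive (x : R) : is_derive x 1 lam (dlam x).
Proof. by rewrite /lam /dlam; apply: is_derive_eq; rewrite /GRing.scale/=; ring. Qed.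

Let sin_cos_le1 (x : R) : `|sin x * cos x| <= 1.
Proof. by rewrite normrM mulr_ile1// ler_norml ?sin_geN1 ?sin_le1 ?cos_geN1 ?cos_le1. Qed.

Let dlam_bound (x : R) : `|dlam x| <= 8 * kap * beta ^+ 2.
Proof.
have c0 : 0 <= 8 * kap * beta ^+ 2 by rewrite !(sqr_ge0, mulr_ge0).
by rewrite /dlam normrN normrM (ger0_norm c0) -[leRHS]mulr1 ler_wpM2l.
Qed.

Let B_sqr : B ^+ 2 = beta ^+ 2 * (p%:R / 2) * q ^+ p.-1.
Proof.
have [q0 _] := andP hq01.
rewrite /B !exprMn sqr_sqrtr ?divr_ge0//; congr (_ * _).
rewrite -(powR_mulrn 2 (powR_ge0 _ _)) -powRrM divfK// -(powR_mulrn _ q0).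
by congr (_ `^ _); rewrite -[in LHS](prednK (ltnW hp)) -natr1 addrK.
Qed.

Section size.
Variable N : nat.
Hypothesis hN : (p <= N)%N.

Notation K := (interaction N p + 'I_N)%type.
Let u : R := u_scale R N p.

Let N0 : (0 < N)%N. Proof. exact: leq_trans (ltnW hp) hN. Qed.
Let N0R : 0 < N%:R :> R. Proof. by rewrite ltr0n. Qed.

Let z (k : K) (s : config N) : R :=
  match k with inl t => \prod_(i <- val t) spin s i | inr i => spin s i end.

(* The interactions come first, so that the given disorder is a prefix of the
   Gaussian family of the interpolation. *)
Let idx (k : K) : nat :=
  match k with inl t => enum_rank t | inr i => (#|{: interaction N p}| + i)%N end.

(* Variances [a k th ^+ 2] are affine in [sin th ^+ 2]; the angle avoids the
   singularity of a square root at the end points. *)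
Let a (k : K) (th : R) : R :=
  match k with inl _ => beta * u * sin th | inr _ => B * cos th end.

Let da (k : K) (th : R) : R :=
  match k with inl _ => beta * u * cos th | inr _ => - (B * sin th) end.

Let y (s t : config N) : R := N%:R * (overlap s t - q) ^+ 2.

Let c (s : config N) : R := h * \sum_i spin s i.

Let spin_sqr (s : config N) i : spin s i ^+ 2 = 1 :> R.
Proof. by rewrite /spin sqrr_sign. Qed.

Let spin_norm (s : config N) i : `|spin s i| = 1 :> R.
Proof. by rewrite /spin normr_sign. Qed.

Let z1 k s : z k s ^+ 2 = 1.
Proof.
case: k => [t|i] /=; last exact: spin_sqr.
by rewrite -prodrXl big1.
Qed.

Let idx_lt k : (idx k < #|{: interaction N p}| + N)%N.
Proof.
case: k => [t|i] /=; last by rewrite ltn_add2l.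
by rewrite ltn_addr.
Qed.

Let idx_inj : injective idx.
Proof.
move=> [t|i] [t'|i'] /= H.
- by congr inl; apply: enum_rank_inj; exact: val_inj.
- by have := ltn_ord (enum_rank t); rewrite H ltnNge leq_addr.
- by have := ltn_ord (enum_rank t'); rewrite -H ltnNge leq_addr.
- by congr inr; apply: val_inj; exact: addnI H.
Qed.

Let a_derive k (x : R) : is_derive x 1 (a k) (da k x).
Proof.
by case: k => [t|i] /=; apply: is_derive_eq; rewrite /GRing.scale/=; ring.
Qed.

Let A : R := `|beta * u| + `|B|.

Let a_bound k x : `|a k x| <= A.
Proof.
have h1 : `|sin x| <= 1 by rewrite ler_norml sin_geN1 sin_le1.
have h2 : `|cos x| <= 1 by rewrite ler_norml cos_geN1 cos_le1.
case: k => [t|i] /=; rewrite normrM.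
  by apply: (@le_trans _ _ `|beta * u|); rewrite ?lerDl// ler_piMr.
by apply: (@le_trans _ _ `|B|); rewrite ?lerDr// ler_piMr.
Qed.

Let da_bound k x : `|da k x| <= A.
Proof.
have h1 : `|sin x| <= 1 by rewrite ler_norml sin_geN1 sin_le1.
have h2 : `|cos x| <= 1 by rewrite ler_norml cos_geN1 cos_le1.
case: k => [t|i] /=; rewrite ?normrN normrM.
  by apply: (@le_trans _ _ `|beta * u|); rewrite ?lerDl// ler_piMr.
by apply: (@le_trans _ _ `|B|); rewrite ?lerDr// ler_piMr.
Qed.

Let y_sym s t : y s t = y t s.
Proof.
rewrite /y /overlap; congr (_ * (_ * _ - _) ^+ 2).
by apply: eq_bigr => i _; rewrite mulrC.
Qed.

Let y_ge0 s t : 0 <= y s t.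
Proof. by rewrite mulr_ge0// sqr_ge0. Qed.

Let overlap_norm (s t : config N) : `|overlap s t| <= 1 :> R.
Proof.
rewrite /overlap normrM normfV (gtr0_norm N0R) mulrC ler_pdivrMr// mul1r.
apply: (le_trans (ler_norm_sum _ _ _)).
rewrite (eq_bigr (fun=> 1)); last by move=> i _; rewrite normrM !spin_norm mulr1.
by rewrite sumr_const card_ord.
Qed.

Let overlap_sub_norm (s t : config N) : `|overlap s t - q| <= 2.
Proof.
by rewrite (le_trans (ler_normB _ _))// mulr2n lerD.
Qed.

Let y_bound s t : y s t <= N%:R * 4.
Proof.
rewrite /y ler_wpM2l// -(real_normK (num_real _)).
have -> : 4 = 2 ^+ 2 :> R by rewrite -natrX.
by rewrite ler_pXn2r// ?nnegrE.
Qed.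

Let covariance_bound (th : R) : 0 < th < pi / 2 ->
  exists k0 K0 C0 : R,
  [/\ 0 <= K0, dlam th + 8 * K0 <= 0, 8 * C0 <= 8 * kap * beta ^+ 2 &
      forall s t, `|\sum_k 2 * (a k th * da k th) * (z k s * z k t) + k0|
        <= K0 * y s t + C0].
Proof.
move=> /andP[th0 th1].
pose sc := sin th * cos th.
have sc0 : 0 <= sc.
  rewrite mulr_ge0// ltW//.
    by apply: sin_gt0_pi; rewrite th0/= (lt_trans th1)// ltr_pdivrMr// ltr_pMr ?pi_gt0// ltr1n.
  by apply: cos_gt0_pihalf; rewrite th1 andbT (lt_trans _ th0)// oppr_lt0 divr_gt0// pi_gt0.
have sc1 : sc <= 1 by apply: le_trans (sin_cos_le1 th); exact: ler_norm.
have b2 : 0 <= beta ^+ 2 by exact: sqr_ge0.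
have K00 : 0 <= kap * beta ^+ 2 * sc by apply: mulr_ge0 => //; exact: mulr_ge0.
(* The first witness supplies the constant term of the tangent of [r^p] at [q]. The second comes
   from the quadratic Taylor bound, the third from tuples with a repeated site; both carry the same
   binomial coefficient. *)
exists (sc * beta ^+ 2 * (N%:R * p.-1%:R * q ^+ p)), (kap * beta ^+ 2 * sc), (kap * beta ^+ 2 * sc).
split => //.
- by rewrite /dlam -/sc le_eqVlt; apply/orP; left; apply/eqP; ring.
- by rewrite -[leRHS]mulrA ler_wpM2l// ler_piMr// mulr_ge0.
move=> s t; rewrite big_sumType/=.
pose x i : R := spin s i * spin t i.
have x1 i : `|x i| <= 1 by rewrite normrM !spin_norm mulr1.
pose e : R := \sum_(j : interaction N p) \prod_(i <- val j) x i.
pose r : R := overlap s t.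
have Nr : \sum_i x i = N%:R * r by rewrite /r /overlap mulrA divff ?mul1r// gt_eqF.
have -> : \sum_(j : interaction N p) 2 * (beta * u * sin th * (beta * u * cos th)) *
    ((\prod_(i <- val j) spin s i) * (\prod_(i <- val j) spin t i)) =
    2 * (beta * u * sin th * (beta * u * cos th)) * e.
  by rewrite mulr_sumr; apply: eq_bigr => j _; rewrite -big_split.
have -> : \sum_(i < N) 2 * (B * cos th * - (B * sin th)) * (spin s i * spin t i) =
    2 * (B * cos th * - (B * sin th)) * (N%:R * r).
  by rewrite -Nr mulr_sumr.
have Np0 : 0 < N%:R ^+ p.-1 :> R by rewrite exprn_gt0.
have u2 : 2 * u ^+ 2 = (p`!)%:R / N%:R ^+ p.-1.
  rewrite /u /u_scale sqr_sqrtr; last by rewrite divr_ge0// mulr_ge0// ltW.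
  by field; rewrite gt_eqF.
have NpE : N%:R ^+ p = N%:R * N%:R ^+ p.-1 :> R.
  by rewrite -exprS prednK// ltnW.
have -> : 2 * (beta * u * sin th * (beta * u * cos th)) * e +
    2 * (B * cos th * - (B * sin th)) * (N%:R * r) +
    sc * beta ^+ 2 * (N%:R * p.-1%:R * q ^+ p) =
  sc * beta ^+ 2 * (((p`!)%:R * e - (N%:R * r) ^+ p) / N%:R ^+ p.-1 +
    N%:R * (r ^+ p - p%:R * q ^+ p.-1 * r + p.-1%:R * q ^+ p)).
  transitivity (sc * beta ^+ 2 * (2 * u ^+ 2) * e - 2 * sc * B ^+ 2 * (N%:R * r) +
      sc * beta ^+ 2 * (N%:R * p.-1%:R * q ^+ p)); first by rewrite /sc; ring.
  rewrite u2 B_sqr exprMn NpE.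
  by field; rewrite expf_neq0 ?gt_eqF.
have -> : kap * beta ^+ 2 * sc * y s t + kap * beta ^+ 2 * sc =
   sc * beta ^+ 2 * (kap + N%:R * (kap * (r - q) ^+ 2)) by rewrite /y -/r; ring.
have scb : 0 <= sc * beta ^+ 2 by rewrite mulr_ge0.
rewrite normrM (ger0_norm scb) ler_wpM2l//.
rewrite (le_trans (ler_normD _ _))// lerD//.
  rewrite normrM normfV (gtr0_norm Np0) ler_pdivrMr// -Nr.
  by apply: sum_interaction_approx => //; exact: ltnW.
rewrite normrM (gtr0_norm N0R) ler_wpM2l//.
exact: (expr_taylor1 (ltnW hp) (overlap_norm s t) q1).
Qed.

Let site (e : bool) (x : R) : R := (1 + (-1) ^+ e * tanh (B * x + h) ^+ 2) / 2.

Let site_meas e : measurable_fun setT (site e).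
Proof.
have m1 : measurable_fun setT (fun x : R => B * x + h).
  by apply: measurable_funD => //; exact: measurable_funM.
have m2 := measurableT_comp (@measurable_tanh R) m1.
apply: measurable_funM => //; apply: measurable_funD => //.
by apply: measurable_funM => //; exact: measurable_funX.
Qed.

Let site_norm e x : `|site e x| <= 1.
Proof.
have /andP[t0 t1] := tanh_sqr_le1 (B * x + h).
by rewrite /site ler_norml; case: e; rewrite ?expr0 ?expr1; lra.
Qed.

(** The fixed point equation enters here: averaged over the site field, the product of the two spins
    has mean exactly [q]. *)
Let site_int e : \int[gauss]_x site e x = (1 + (-1) ^+ e * q) / 2.
Proof.
pose t (x : R) := tanh (B * x + h) ^+ 2.
have m1 : measurable_fun setT (fun x : R => B * x + h).
  by apply: measurable_funD => //; exact: measurable_funM.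
have mt : measurable_fun setT t.
  have m2 := measurableT_comp (@measurable_tanh R) m1.
  exact: measurable_funX.
have it : gauss.-integrable setT (EFin \o t).
  apply: (@bounded_integrable _ _ (measurableTypeR R) gauss t 1 mt) => x.
  by have /andP[t0 t1] := tanh_sqr_le1 (B * x + h); rewrite ger0_norm.
have qE : q = \int[gauss]_x t x.
  rewrite /Rintegral; have := hq; rewrite /overlap_fixpoint unlock => <-.
  by [].
have ic : gauss.-integrable setT (EFin \o cst (2^-1 : R)).
  exact: finite_measure_integrable_cst.
have iz := integrableZl measurableT ((-1) ^+ e / 2) it.
transitivity (\int[gauss]_x (cst 2^-1 x + (-1) ^+ e / 2 * t x)).
  by apply: eq_Rintegral => x _; rewrite /site /t /=; field.
refine (etrans (RintegralD measurableT ic iz) _).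
refine (etrans (congr2 +%R (congr1 fine (integralT_cst gauss (2^-1 : R)%:E))
  (RintegralZl _ measurableT it)) _).
by rewrite -qE /=; field.
Qed.

(** * Interpolation for the p-spin model at fixed [N] *)

Section space.
Context {d : measure_display} {T : measurableType d} (Q : probability T R).
Variable X : nat -> T -> R.
Hypothesis mX : forall k, measurable_fun setT (X k).
Hypothesis iX : forall k, (k < #|{: interaction N p}| + N)%N -> Q.-integrable setT (EFin \o X k).
Hypothesis ibpX : ibp_prop (#|{: interaction N p}| + N) Q X.
Hypothesis prodX : prod_prop (#|{: interaction N p}| + N) Q X.

Let s0 : config N := [ffun=> false].

Let interp (th : R) : R := \int[Q]_w av (energy idx z c a th (X ^~ w))
  (fun s t => expR (lam th * y s t)).

Let interp_le : interp (pi / 2) <= expR (8 * kap * beta ^+ 2 * (pi / 2)) * interp 0.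
Proof.
apply: (interpolant_le s0 mX idx_lt idx_inj iX ibpX c z1 a_derive y_sym y_ge0
  lam_derive _ a_bound da_bound y_bound lam_le dlam_bound).
- by move=> x; apply: le_trans (lam_ge x).
- by rewrite divr_ge0// pi_ge0.
- exact: covariance_bound.
Qed.

Let prodX_site (e : {ffun 'I_N -> bool}) :
  Q.-integrable setT (EFin \o (fun w => \prod_(i < N) site (e i) (X (#|{: interaction N p}| + i)%N w))) /\
  \int[Q]_w (\prod_(i < N) site (e i) (X (#|{: interaction N p}| + i)%N w)) =
  \prod_(i < N) ((1 + (-1) ^+ e i * q) / 2).
Proof.
set M0 := #|_|.
split.
  apply: (@bounded_integrable _ _ _ _ _ 1).
    by apply: measurable_prod => i _; exact: (measurableT_comp (site_meas _) (mX _)).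
  by move=> w; rewrite normr_prod; apply: prodr_ile1 => i _; rewrite normr_ge0 site_norm.
(* At most one factor differs from 1, so [F k] is constant on interaction coordinates and equals the
   site weight at coordinate [M0 + i]. *)
pose F (k : nat) (x : R) : R := \prod_(i < N) (if (M0 + i)%N == k then site (e i) x else 1).
have FM (i : 'I_N) x : F (M0 + i)%N x = site (e i) x.
  rewrite /F -big_mkcond/= (big_pred1 i)// => j.
  by rewrite eqn_add2l.
have F1 (k : 'I_M0) x : F k x = 1.
  rewrite /F big1// => i _; rewrite gtn_eqF//.
  exact: leq_trans (ltn_ord k) (leq_addr _ _).
have := prodX (F := F); rewrite big_split_ord/= big1 ?mul1r; last first.
  move=> k _; transitivity (\int[gauss]_x (1 : R)).
    by apply: eq_Rintegral => x _; rewrite F1.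
  exact: (congr1 fine (integralT_cst gauss (1 : R)%:E)).
move=> HP; transitivity (\int[Q]_w (\prod_(k < M0 + N) F k (X k w))).
  apply: eq_Rintegral => w _; rewrite [RHS]big_split_ord/= [X in _ = X * _]big1 ?mul1r.
    by apply: eq_bigr => i _; rewrite FM.
  by move=> k _; rewrite F1.
rewrite HP.
- apply: eq_bigr => i _; rewrite -site_int; apply: eq_Rintegral => x _.
  by rewrite FM.
- move=> k; apply: measurable_prod => i _.
  by case: ((M0 + i)%N == k); [exact: site_meas|exact: measurable_cst].
- move=> k x; rewrite normr_prod; apply: prodr_ile1 => i _; rewrite normr_ge0/=.
  by case: ifP => _; rewrite ?site_norm ?normr1.
Qed.

(** At angle 0 the energy is a sum of independent site fields, and the overlap depends on the
    sitewise product of the replicas alone. Averaging over the fields leaves independent signs of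
    mean [q]. *)
Let interp0 : interp 0 <= 2 * expR (3 / 2) / (1 - expR (- 2^-1)).
Proof.
pose F (e : {ffun 'I_N -> bool}) : R :=
  expR (6^-1 * N%:R * (N%:R^-1 * (\sum_i (-1) ^+ e i) - q) ^+ 2).
have -> : interp 0 = \int[Q]_w (\sum_(e : {ffun 'I_N -> bool})
    F e * \prod_(i < N) site (e i) (X (#|{: interaction N p}| + i)%N w)).
  apply: eq_Rintegral => w _.
  rewrite -(av_product_field (fun i => B * X (#|{: interaction N p}| + i)%N w + h)).
  have -> : energy idx z c a 0 (X ^~ w) =
     (fun s => \sum_(i < N) (B * X (#|{: interaction N p}| + i)%N w + h) * spin s i).
    apply/funext => s; rewrite /energy big_sumType/= big1 ?add0r; last first.
      by move=> t _; rewrite sin0 mulr0 !mul0r.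
    rewrite /c mulr_sumr -big_split/=; apply: eq_bigr => i _.
    by rewrite cos0 mulr1 mulrDl.
  apply: eq_av => s t.
  have Eo : overlap s t = N%:R^-1 *
      (\sum_(i < N) (-1) ^+ ([ffun j => s j (+) t j] : {ffun 'I_N -> bool}) i) :> R.
    rewrite /overlap; apply: congr1; apply: eq_bigr => i _.
    by rewrite /spin ffunE signr_addb.
  rewrite /F -Eo /y mulrA; apply: congr1; apply: (congr1 (fun x => x * N%:R * _)).
  by rewrite /lam sin0 expr0n/= mulr0 subr0.
have iF e := integrableZl measurableT (F e) (prodX_site e).1.
have [_ ->] := Rintegral_fsum iF.
apply: le_trans (@binary_square_exp R q _ N N0); last first.
  by have /andP[q0 ->] := hq01; rewrite andbT (le_trans _ q0).
rewrite le_eqVlt; apply/orP; left; apply/eqP; apply: eq_bigr => e _.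
by rewrite (RintegralZl (F e) measurableT (prodX_site e).1) (prodX_site e).2 mulrC.
Qed.

(** At angle [pi / 2] the energy is the original one. The estimate [x^l <= l^l expR x] is used with
    [x = y / 24], since [lam] stays above [1 / 24]. *)
Lemma moment_le (l : nat) : (0 < l)%N ->
  \int[Q]_w av (fun s => - hamiltonian beta h (fun t : interaction N p => X (enum_rank t) w) s)
    (fun s t => (overlap s t - q) ^+ (2 * l)) <=
  (l%:R / (24^-1 * N%:R)) ^+ l * (expR (8 * kap * beta ^+ 2 * (pi / 2)) *
    (2 * expR (3 / 2) / (1 - expR (- 2^-1)))).
Proof.
move=> l0; set k := l%:R / (24^-1 * N%:R).
have k0 : 0 <= k by rewrite divr_ge0// mulr_ge0.
apply: (@le_trans _ _ (k ^+ l * interp (pi / 2))); last first.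
  rewrite ler_wpM2l ?exprn_ge0// (le_trans interp_le)//.
  by rewrite ler_wpM2l ?expR_ge0.
have EH w : (fun s => - hamiltonian beta h (fun t : interaction N p => X (enum_rank t) w) s) =
   energy idx z c a (pi / 2) (X ^~ w).
  apply/funext => s; rewrite /energy /hamiltonian opprK big_sumType/= [X in _ + X + _]big1.
    rewrite addr0 /c; congr (_ + _); rewrite mulr_sumr; apply: eq_bigr => t _.
    by rewrite sin_pihalf mulr1 mulrA.
  by move=> i _; rewrite cos_pihalf mulr0 !mul0r.
have me s : measurable_fun setT (fun w => energy idx z c a (pi / 2) (X ^~ w) s).
  apply: measurable_funD => //; apply: measurable_sum => j.
  by apply: measurable_funM => //; exact: measurable_funM.
have i1 : Q.-integrable setT (EFin \o (fun w => av (energy idx z c a (pi / 2) (X ^~ w))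
   (fun s t => (overlap s t - q) ^+ (2 * l)))).
  apply: (@bounded_integrable _ _ _ _ _ (2 ^+ (2 * l))).
    exact: (measurable_av s0 (e := fun s w => energy idx z c a (pi / 2) (X ^~ w) s)).
  move=> w; apply: av_norm => // s t; rewrite normrX lerXn2r ?nnegrE//.
have i2 : Q.-integrable setT (EFin \o (fun w => av (energy idx z c a (pi / 2) (X ^~ w))
   (fun s t => expR (lam (pi / 2) * y s t)))).
  apply: (@bounded_integrable _ _ _ _ _ (expR (6^-1 * (N%:R * 4)))).
    exact: (measurable_av s0 (e := fun s w => energy idx z c a (pi / 2) (X ^~ w) s)).
  move=> w; apply: av_norm => // s t; rewrite ger0_norm ?expR_ge0// ler_expR ler_pM//.
  by apply: le_trans (lam_ge _).
rewrite /interp -(RintegralZl (k ^+ l) measurableT i2).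
under eq_Rintegral do rewrite EH.
apply: le_Rintegral => //; first exact: (integrableZl measurableT (k ^+ l) i2).
move=> w _; rewrite -avZ; apply: av_le => // s t.
have y24 : 0 <= 24^-1 * y s t by rewrite mulr_ge0.
apply: (@le_trans _ _ (k ^+ l * expR (24^-1 * y s t))); last first.
  by rewrite ler_wpM2l ?exprn_ge0// ler_expR ler_wpM2r.
have -> : (overlap s t - q) ^+ (2 * l) = (24^-1 * y s t) ^+ l / (24^-1 * N%:R) ^+ l.
  rewrite exprM -expr_div_n; congr (_ ^+ _); rewrite /y.
  by field; rewrite gt_eqF.
rewrite /k expr_div_n mulrAC ler_pM2r ?invr_gt0 ?exprn_gt0 ?mulr_gt0//.
exact: expr_le_expR.
Qed.

End space.

Lemma nu_moment_le (l : nat) d (T : measurableType d) (P : probability T R)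
    (g : interaction N p -> {RV P >-> R}) :
  (0 < l)%N -> (forall t, standard_gaussian (g t)) -> mutually_independent g ->
  (nu beta h g (fun s : {ffun 'I_2 -> config N} => ((R12 s - q) ^+ (2 * l))%R)
     <= ((l%:R / (24^-1 * N%:R)) ^+ l * (expR (8 * kap * beta ^+ 2 * (pi / 2)) *
    (2 * expR (3 / 2) / (1 - expR (- 2^-1)))))%:E)%E.
Proof.
move=> l0 hg hi.
have [d' [T' [Q [X [mX iX ibp pp [_ tr]]]]]] :=
  @gaussian_space R (#|{: interaction N p}| + N)%N.
pose F (x : nat -> R) : R :=
  av (fun s => - hamiltonian beta h (fun t : interaction N p => x (enum_rank t)) s)
    (fun s t => (overlap s t - q) ^+ (2 * l)).
have mF : meas_op F.
  move=> d1 T1 X1 mX1; apply: (measurable_av [ffun=> false]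
    (e := fun s w => - hamiltonian beta h (fun t : interaction N p => X1 (enum_rank t) w) s)) => s.
  apply: measurable_funN; apply: measurable_funN; apply: measurable_funD => //.
  apply: measurable_funM => //; apply: measurable_sum => t.
  exact: measurable_funM.
have bF x : `|F x| <= 2 ^+ (2 * l).
  by apply: (av_norm [ffun=> false]) => s t; rewrite normrX lerXn2r ?nnegrE.
have dF x x' : (forall k, (k < #|{: interaction N p}|)%N -> x k = x' k) -> F x = F x'.
  move=> xx; rewrite /F; congr (av _ _); apply/funext => s; congr (- _).
  by rewrite /hamiltonian; congr (- (_ * _ + _)); apply: eq_bigr => t _; rewrite xx.
(* The Gibbs average reads the interaction coordinates alone, so the disorder on [P] is compared
   with a prefix of the larger Gaussian family. *)
have E := tr _ (leq_addr _ _) _ _ P (nat_family g) (nat_family_meas g)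
  (nat_family_law hg hi) F _ mF bF dF.
have EG w : F ((nat_family g) ^~ w) =
    gibbs beta h (fun t => g t w) (fun s : {ffun 'I_2 -> config N} => (R12 s - q) ^+ (2 * l)).
  rewrite (gibbs_av _ _ _ (fun s t => (overlap s t - q) ^+ (2 * l))) /F.
  congr (av _ _); apply/funext => s; congr (- _).
  rewrite /hamiltonian; congr (- (_ * _ + _)); apply: eq_bigr => t _.
  by rewrite nat_family_rank.
have iP : P.-integrable setT (EFin \o (fun w => F ((nat_family g) ^~ w))).
  by apply: (@bounded_integrable _ _ _ _ _ (2 ^+ (2 * l))) => //; apply: mF; exact: nat_family_meas.
have -> : nu beta h g (fun s : {ffun 'I_2 -> config N} => ((R12 s - q) ^+ (2 * l))%R) =
    (\int[P]_w F ((nat_family g) ^~ w))%:E.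
  rewrite /Rintegral fineK; last exact: integrable_fin_num.
  rewrite /nu unlock; apply: eq_integral => w _.
  by rewrite EG.
rewrite E lee_fin; exact: moment_le.
Qed.

End size.
End model.

Unset Implicit Arguments.

Theorem theorem3p4 (R : realType) (p : nat) (h beta betap q : R)
  (hp : (2 <= p)%N)
  (hh : 0 < h)
  (hbetap0 : 0 < betap)
  (hbetap : 8 * p%:R ^+ 2 * betap ^+ 2 * expR (16 * betap ^+ 2 * p%:R) = 2^-1)
  (hbeta0 : 0 < beta)
  (hbeta : beta < betap)
  (hq01 : 0 <= q <= 1)
  (hq : overlap_fixpoint p beta h q) :
  exists L : R,
    forall (l N : nat) (d : measure_display) (T : measurableType d)
      (P : probability T R) (g : interaction N p -> {RV P >-> R}),
      (1 <= l)%N -> (p <= N)%N ->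
      (forall t, standard_gaussian (g t)) ->
      mutually_independent g ->
      (nu beta h g (fun s : {ffun 'I_2 -> config N} => ((R12 s - q) ^+ (2 * l))%R)
         <= ((L * l%:R / N%:R) ^+ l)%:E)%E.
Proof.
have b2 : beta ^+ 2 <= betap ^+ 2 by rewrite ler_pXn2r ?nnegrE ?ltW.
(* The exponential in the equation for [betap] is at least 1, so [8 p^2 betap^2 <= 1/2]. *)
have hb : 16 * p%:R ^+ 2 * beta ^+ 2 <= 1.
  have c0 : 0 <= 8 * p%:R ^+ 2 * betap ^+ 2 by rewrite !(sqr_ge0, mulr_ge0).
  have e1 : 1 <= expR (16 * betap ^+ 2 * p%:R).
    by rewrite -[leLHS]expR0 ler_expR !(sqr_ge0, mulr_ge0).
  have h1 := ler_wpM2l c0 e1; rewrite hbetap mulr1 in h1.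
  have p0 : 0 <= p%:R ^+ 2 :> R by exact: sqr_ge0.
  have h2 := ler_wpM2l p0 b2; lra.
pose D : R := expR (8 * 'C(p, 2)%:R * beta ^+ 2 * (pi / 2)) *
    (2 * expR (3 / 2) / (1 - expR (- 2^-1))).
have D0 : 0 <= D.
  by rewrite mulr_ge0 ?expR_ge0// divr_ge0 ?mulr_ge0 ?expR_ge0// subr_ge0.
(* The prefactor [D] depends on neither [l] nor [N]. It goes inside the power through
   [D <= 1 + D <= (1 + D)^l], valid as [l >= 1]. *)
exists (24 * (1 + D)) => l N d T P g l1 pN hg hi.
apply: (le_trans (nu_moment_le hp hb hq01 hq pN l1 hg hi)).
have N0 : 0 < N%:R :> R by rewrite ltr0n (leq_trans _ pN)// ltnW.
rewrite lee_fin -/D.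
have -> : 24 * (1 + D) * l%:R / N%:R = l%:R / (24^-1 * N%:R) * (1 + D).
  by field; rewrite gt_eqF.
rewrite [leRHS]exprMn ler_wpM2l ?exprn_ge0 ?divr_ge0 ?mulr_ge0 ?(ltW N0)//.
apply: (@le_trans _ _ (1 + D)); first by rewrite lerDr.
by rewrite -[leLHS]expr1 ler_weXn2l// lerDl.
Qed.
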